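(* Let $\mathbb{B}^n=(\mathbb{B}^n(t))_{t\ge0}$ be the Brownian motion on the flat torus $\mathbb{T}^n:=(\mathbb{R}/2\mathbb{Z})^n$ started at $0$, and let $\mu_{\mathbb{T}^n}$ be the uniform probability measure on $\mathbb{T}^n$. There is a cutoff in separation for the family $(\mathbb{B}^n)_{n\ge2}$ with cutoff times $\frac{2\log(n)}{\pi^2}$; that is, with $a_n=\frac{2\log (n)}{\pi^2}$, $$\forall r>0,\quad \lim_{n\to\infty}\mathfrak{s}\big(\mathcal{L}(\mathbb{B}^n((1+r)a_n)),\mu_{\mathbb{T}^n}\big)=0,$$ $$\forall r\in(0,1),\quad \lim_{n\to\infty}\mathfrak{s}\big(\mathcal{L}(\mathbb{B}^n((1-r)a_n)),\mu_{\mathbb{T}^n}\big)=1.$$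
   Context: Brownian motion on $\mathbb{T}^n$ is the projection modulo $2\mathbb{Z}$ (coordinatewise) of the standard Brownian motion $(B^1_t,\dots,B^n_t)$ on $\mathbb{R}^n$ (generator $\frac12\sum_i\partial_i^2$). $\mathcal{L}(Y)$ denotes the law of $Y$. The separation discrepancy between probability measures $\mu,\nu$ on the same measurable space is $\mathfrak{s}(\mu,\nu)=\operatorname{ess\,sup}_{\nu}\big(1-\frac{d\mu}{d\nu}\big)$, where $d\mu/d\nu$ is the Radon-Nikodym derivative of the absolutely continuous part of $\mu$ with respect to $\nu$. *)

(* Defs.v *)
From HB Require Import structures.
From mathcomp Require Import all_boot all_order all_algebra.
From mathcomp Require Import generic_quotient ring_quotient archimedean.
From mathcomp Require Import all_classical all_reals all_analysis.
From mathcomp Require Import ess_sup_inf.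

Set Implicit Arguments.
Unset Strict Implicit.
Unset Printing Implicit Defensive.

Import Order.TTheory GRing.Theory Num.Theory.
Import numFieldNormedType.Exports.

Local Open Scope classical_set_scope.
Local Open Scope ring_scope.

(* [uniform_prob] and [normal_prob] are probabilities on [measurableTypeR R],
   which has the same sigma-algebra as [R] but another display. [real_prob P] is
   [P] seen as a probability on [R]. *)
Section real_prob.
Variable R : realType.

Definition real_id : measurableTypeR R -> R := idfun.

Lemma measurable_real_id : measurable_fun [set: measurableTypeR R] real_id.
Proof. by move=> _ A mA; rewrite setTI. Qed.

HB.instance Definition _ :=
  isMeasurableFun.Build _ _ (measurableTypeR R) R real_id measurable_real_id.

Definition real_prob (P : probability (measurableTypeR R) R) :
  probability R R := distribution P real_id.

End real_prob.

Section even_integers.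
Variable R : realType.

Definition even_integer : {pred R} := [pred x : R | x / 2 \is a Num.int].

Lemma even_integer_zmod_closed : zmod_closed even_integer.
Proof.
split=> [|x y]; first by rewrite inE/= mul0r rpred0.
by rewrite !inE/= mulrBl => /rpredB; apply.
Qed.

HB.instance Definition _ :=
  GRing.isZmodClosed.Build R even_integer even_integer_zmod_closed.

End even_integers.

Definition circle (R : realType) : Type := Quotient.quot (@even_integer R).

Fact circle_display : measure_display.
Proof. exact: default_measure_display. Qed.

Section circle.
Variable R : realType.

HB.instance Definition _ := GRing.Zmodule.on (circle R).
HB.instance Definition _ := isPointed.Build (circle R) 0.

Definition circle_proj (x : R) : circle R :=
  (\pi_(Quotient.quot (@even_integer R)) x)%qT.

(* Quotient sigma-algebra: a set is measurable iff its preimage in [R] is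
   Borel. It is the Borel sigma-algebra of the quotient topology. *)
Definition circle_measurable : set (set (circle R)) :=
  image_set_system [set: R] circle_proj measurable.

Let circle_sigma_algebra : sigma_algebra [set: circle R] circle_measurable.
Proof. exact/sigma_algebra_image/sigma_algebra_measurable. Qed.

Let circle_set0 : circle_measurable set0.
Proof. by case: circle_sigma_algebra. Qed.

Let circle_setC A : circle_measurable A -> circle_measurable (~` A).
Proof. by case: circle_sigma_algebra => _ + _ => /[apply]; rewrite setTD. Qed.

Let circle_bigcup (F : (set (circle R))^nat) :
  (forall i, circle_measurable (F i)) -> circle_measurable (\bigcup_i F i).
Proof. by case: circle_sigma_algebra => _ _; apply. Qed.

HB.instance Definition _ := @isMeasurable.Build circle_display (circle R)
  circle_measurable circle_set0 circle_setC circle_bigcup.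

Lemma measurable_circle_proj : measurable_fun [set: R] circle_proj.
Proof. by move=> _ A mA. Qed.

HB.instance Definition _ :=
  isMeasurableFun.Build _ _ R (circle R) circle_proj measurable_circle_proj.

End circle.

(* The flat torus (R / 2Z)^n, with the product sigma-algebra *)
Notation torus R n := (n.-tuple (circle R)).

Section torus_proj.
Variables (R : realType) (n : nat).

Definition torus_proj (x : n.-tuple R) : torus R n :=
  [tuple circle_proj (tnth x i) | i < n].

Lemma measurable_torus_proj : measurable_fun [set: n.-tuple R] torus_proj.
Proof.
apply/measurable_fun_tnthP => i.
rewrite (_ : _ \o _ = @circle_proj R \o (@tnth n R ^~ i)); last first.
  by apply/funext => x /=; rewrite tnth_mktuple.
by apply: measurableT_comp => //; exact: measurable_tnth.
Qed.

HB.instance Definition _ :=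
  isMeasurableFun.Build _ _ (n.-tuple R) (torus R n) torus_proj
    measurable_torus_proj.

End torus_proj.

Section product_power.
Context d (T : measurableType d) (R : realType).

Definition tuple_cons n (x : T * n.-tuple T) : n.+1.-tuple T :=
  [tuple of x.1 :: x.2].

Lemma measurable_tuple_cons n : measurable_fun setT (@tuple_cons n).
Proof. exact: measurable_cons. Qed.

HB.instance Definition _ n := isMeasurableFun.Build _ _ (T * n.-tuple T)%type
  (n.+1.-tuple T) (@tuple_cons n) (@measurable_tuple_cons n).

(* The n-fold product measure P^n on T^n *)
Fixpoint product_power (P : probability T R) n : probability (n.-tuple T) R :=
  match n with
  | 0 => \d_([tuple] : 0.-tuple T)
  | n.+1 => distribution (P \x product_power P n)%E (@tuple_cons n)
  end.

End product_power.

Section uniform.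
Variable R : realType.

Definition circle_uniform : probability (circle R) R :=
  distribution (real_prob (uniform_prob (@ltr0Sn R 1))) (@circle_proj R).

Definition torus_uniform n : probability (torus R n) R :=
  product_power circle_uniform n.

End uniform.

Section separation.
Context d (T : measurableType d) (R : realType).
Local Open Scope ereal_scope.
Local Open Scope charge_scope.

Definition mutually_singular (mu nu : {measure set T -> \bar R}) :=
  exists N, [/\ measurable N, mu N = 0 & nu (~` N) = 0].

Definition lebesgue_decomposition (mu nu mua mus : {measure set T -> \bar R}) :=
  [/\ mua `<< nu, mutually_singular mus nu &
      forall A, measurable A -> mu A = mua A + mus A].

(* [f] is a version of the Radon-Nikodym derivative with respect to [nu] of the
   absolutely continuous part of [mu]. *)
Definition is_ac_density (mu nu : probability T R) (f : T -> \bar R) :=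
  exists mua mus : {finite_measure set T -> \bar R},
    lebesgue_decomposition mu nu mua mus /\
    f = 'd (charge_of_finite_measure mua) '/d nu.

(* A version always exists (Lebesgue decomposition theorem) and is unique up to
   [nu]-almost-everywhere equality; the default value [cst 0] is not used. *)
Definition ac_density (mu nu : probability T R) : T -> \bar R :=
  xget (cst 0) (is_ac_density mu nu).

Definition separation (mu nu : probability T R) : \bar R :=
  ess_sup nu (fun x => 1 - ac_density mu nu x).

End separation.

Section brownian_motion.
Context d (Omega : measurableType d) (R : realType) (P : probability Omega R).
Variable n : nat.
Implicit Type B : R -> {mfun Omega >-> n.-tuple R}.

Definition increment B (s t : R) (w : Omega) : n.-tuple R :=
  [tuple tnth (B t w) i - tnth (B s w) i | i < n].

Definition independent_increments B :=
  forall (k : nat) (t : nat -> R) (A : nat -> set (n.-tuple R)),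
    0 <= t 0%N -> {homo t : i j / (i <= j)%N >-> i <= j} ->
    (forall i, measurable (A i)) ->
    P (\bigcap_(i in `I_k) (increment B (t i) (t i.+1) @^-1` A i)) =
    (\prod_(i < k) P (increment B (t i) (t i.+1) @^-1` A i))%E.

(* [B t - B s] has law N(0, (t - s) I_n); [normal_prob] takes the standard
   deviation as second parameter. *)
Definition gaussian_increments B :=
  forall (s t : R) (A : set (n.-tuple R)), 0 <= s -> s < t -> measurable A ->
    P (increment B s t @^-1` A) =
    product_power (real_prob (normal_prob 0 (Num.sqrt (t - s)))) n A.

(* Standard [n]-dimensional Brownian motion started at [0]. Only the values at
   times [t >= 0] are constrained. *)
Definition brownian_motion B :=
  [/\ {ae P, forall w, B 0 w = [tuple 0 | _ < n]},
      independent_increments B,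
      gaussian_increments B &
      {ae P, forall w, forall i : 'I_n,
        {within `[0, +oo[, continuous (fun t => tnth (B t w) i)}}].

Definition torus_brownian_law B (t : R) : probability (torus R n) R :=
  distribution P (@torus_proj R n \o B t).

End brownian_motion.

Definition cutoff_time (R : realType) (n : nat) : R := 2 * ln n%:R / pi ^+ 2.

(* Main.v *)
Require Import Defs.
From HB Require Import structures.
From mathcomp Require Import all_boot all_order all_algebra.
From mathcomp Require Import all_classical all_reals all_analysis.
From mathcomp Require Import measurable_realfun ess_sup_inf.
From mathcomp Require Import ring lra.

(** The coordinates of the Brownian motion at time [t] on the [n]-dimensional
    torus are independent, and each of them follows the centred Gaussian law of
    variance [t] wrapped around the circle of length 2. Its first Fourier
    coefficient is [q = exp (- pi^2 t / 2)], which equals [n ^ (- a)] at [a]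
    times the cutoff time, and its density with respect to the uniform law is
    [1 + 2 sum_k q ^ (k^2) cos (pi k x)], with minimum close to [1 - 2 q]. The
    infimum of the product density is thus about [(1 - 2 q) ^ n], and the
    separation tends to 0 or to 1 according as [n q] tends to 0 or to
    infinity.

    This is carried out with two inequalities between the wrapped Gaussian [W]
    and the uniform law [U] on a single circle.

    - [W >= (1 - 2 q / (1 - q)) U] ([wrapped_gaussian_uniform_ge]). Smoothing
      the Gaussian by a Fejer kernel produces a trigonometric polynomial whose
      coefficients are at most the [q ^ (k^2)], so that the smoothed law
      satisfies the inequality ([fejer_gaussian]). The kernel concentrates at
      the origin and the Gaussian mass of a fixed set is continuous under
      translation ([normal_prob_near0]), so the inequality survives in the limit
      ([wrapped_gaussian_ge]). The concentration enters through the fact that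
      the product of the unnormalised kernel with [1 - cos] stays below 2,
      whereas its mass grows linearly.

    - For [u < q] some set [A] satisfies [W A < (1 - u) U A]
      ([wrapped_gaussian_uniform_lt]). Otherwise [W - (1 - u) U] would be a
      positive measure of mass [u] with first Fourier coefficient [q > u].

    The first inequality goes to product measures with its constant raised to
    the power [n] ([product_power_ge]), and the second one does so on the cube
    [A ^ n]. By [separation_le] and [separation_ge] the separation on the torus
    lies between [1 - (1 - u) ^ n] and [1 - (1 - 2 q / (1 - q)) ^ n]. *)

Import Order.TTheory GRing.Theory Num.Theory.
Import numFieldNormedType.Exports.

Set Implicit Arguments.
Unset Strict Implicit.
Unset Printing Implicit Defensive.

Local Open Scope classical_set_scope.
Local Open Scope ring_scope.

(** * Separation discrepancy and comparison of measures *)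

Section separation_bounds.
Context d (T : measurableType d) (R : realType) (mu nu : probability T R).
Hypothesis munu : mu `<< nu.
Local Open Scope ereal_scope.

(** Under absolute continuity the decomposition with zero singular part is
    admissible, so that the default value in the definition is never taken. *)
Lemma is_ac_density_ac_density : is_ac_density mu nu (ac_density mu nu).
Proof.
apply: (@xgetPex _ (cst 0) (is_ac_density mu nu)).
exists (Radon_Nikodym (charge_of_finite_measure mu) nu), mu, mzero.
split=> //; split=> //.
- by exists setT; split; rewrite ?setCT.
- by move=> A mA; rewrite /mzero adde0.
Qed.

(** If the density were almost everywhere above a number larger than [a],
    integrating it over [A] would give [mu] more mass there than [a] times that
    of [nu]. *)
Lemma separation_ge (a : R) (A : set T) : (0 <= a)%R -> measurable A ->
  0 < nu A -> mu A <= a%:E * nu A -> (1 - a)%:E <= separation mu nu.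
Proof.
move=> a0 mA nuA muA.
have [mua [mus [[mua_nu _ muE] fE]]] := is_ac_density_ac_density.
rewrite leNgt; apply/negP => sep.
have [m [sepm ma]] : exists m : R, separation mu nu <= m%:E /\ (m < 1 - a)%R.
  case: (separation mu nu) sep => [s| |] //.
    by rewrite lte_fin => sa; exists s.
  move=> _; exists (1 - a - 1)%R.
  by split; [rewrite leNye|rewrite ltrBlDr ltrDl].
move/ess_supP : sepm; rewrite fE.
set f := Radon_Nikodym _ _ => fm.
have mf : nu.-integrable A f.
  by apply: (integrableS measurableT) => //; exact: Radon_Nikodym_integrable.
have fin x : f x \is a fin_num by exact: Radon_Nikodym_fin_num.
(* a version of the density for which the bound holds everywhere *)
pose g x : \bar R := maxe (1 - m)%:E (f x).
have mg : measurable_fun A g.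
  by apply: measurable_maxe => //; exact: measurable_int mf.
have fg : ae_eq nu A f g.
  apply: filterS fm => x; rewrite /g -(fineK (fin x)) -EFinB lee_fin => fx _.
  by rewrite max_r// lee_fin lerBlDr -lerBlDl.
have : \int[nu]_(x in A) (1 - m)%:E <= \int[nu]_(x in A) g x.
  apply: ge0_le_integral => //.
  - by move=> x _; rewrite lee_fin subr_ge0; move: a0 ma; lra.
  - by move=> x _; rewrite /g le_max lexx.
rewrite integral_cst//.
rewrite -(@ae_eq_integral _ _ _ nu A g f)//; last exact: measurable_int mf.
rewrite -Radon_Nikodym_integral// => muaA.
have : (1 - m)%:E * nu A <= a%:E * nu A.
  apply: (le_trans muaA); apply: le_trans muA.
  by rewrite muE// leeDl.
rewrite -(fineK (fin_num_measure nu A mA)) -!EFinM lee_fin ler_pM2r.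
  by rewrite lerBlDl -lerBlDr leNgt ma.
by rewrite fine_gt0// nuA ltey_eq fin_num_measure.
Qed.

(** The lower bound on [mu] passes to its absolutely continuous part, because
    the singular part is carried by a set that [nu] does not see; the density
    is then at least [c] almost everywhere. *)
Lemma separation_le (c : R) :
  (forall A, measurable A -> c%:E * nu A <= mu A) ->
  separation mu nu <= (1 - c)%:E.
Proof.
move=> cnu.
have [mua [mus [[mua_nu [N [mN musN nuN]] muE] fE]]] :=
  is_ac_density_ac_density.
apply/ess_supP; rewrite fE; set f := Radon_Nikodym _ _.
have intf : nu.-integrable setT f by exact: Radon_Nikodym_integrable.
have mf : measurable_fun setT f by exact: measurable_int intf.
have fin x : f x \is a fin_num by exact: Radon_Nikodym_fin_num.
pose E := [set x | f x < c%:E].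
have mE : measurable E.
  by rewrite -[X in measurable X]setTI; exact: emeasurable_fun_infty_o.
have muaE : c%:E * nu E <= mua E.
  have -> : nu E = nu (E `&` N).
    have -> : nu E = nu (E `&` N) + nu (E `&` ~` N).
      rewrite -measureU//; [|exact: measurableI|apply: measurableI => //|].
      - by rewrite -setIUr setUv setIT.
      - exact: measurableC.
      - by rewrite setIACA setICr setI0.
    rewrite [X in _ + X](_ : _ = 0) ?adde0//.
    apply/eqP; rewrite -measure_le0 -nuN le_measure ?inE//.
      by apply: measurableI => //; exact: measurableC.
    exact: measurableC.
  apply: (le_trans (cnu _ (measurableI _ _ mE mN))).
  rewrite muE; last exact: measurableI.
  rewrite [X in _ + X](_ : _ = 0).
    rewrite adde0 le_measure ?inE//; first exact: measurableI.
  apply/eqP; rewrite -measure_le0 -musN le_measure ?inE//.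
  exact: measurableI.
have intfE : nu.-integrable E f by exact: integrableS intf.
have intc : nu.-integrable E (cst c%:E).
  apply: (integrableS measurableT) => //.
  exact: finite_measure_integrable_cst.
have int0 : \int[nu]_(x in E) `|c%:E - f x| = 0.
  apply/eqP; rewrite eq_le integral_ge0// andbT.
  rewrite (eq_integral (fun x => c%:E - f x)); last first.
    by move=> x; rewrite inE => Ex; rewrite gee0_abs// sube_ge0 ?fin// ltW.
  rewrite integralB// integral_cst//= -Radon_Nikodym_integral//=.
  by rewrite lee_subel_addr ?add0e// fin_num_measure.
have : ae_eq nu E (fun x => c%:E - f x) (cst 0).
  apply/(ae_eq_integral_abs nu mE) => //.
  by apply: emeasurable_funB => //; exact: measurable_int intfE.
apply: filterS => x; rewrite -(fineK (fin x)) -EFinB => h.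
rewrite lee_fin lerB// leNgt; apply/negP => fc.
have Ex : E x by rewrite /E /= -(fineK (fin x)) lte_fin.
move: (h Ex) => -[] /eqP; rewrite subr_eq0 => /eqP cE.
by rewrite -cE ltxx in fc.
Qed.

(** The density integrates to at most [1]: take the whole space. *)
Lemma separation_ge0 : 0 <= separation mu nu.
Proof.
rewrite -[leLHS]/(0%R%:E) -(subrr 1%R); apply: (@separation_ge _ setT) => //.
  by rewrite probability_setT lte01.
by rewrite !probability_setT mul1e.
Qed.

Lemma separation_le1 : separation mu nu <= 1.
Proof.
rewrite -[leRHS]/(1%R%:E) -(subr0 1%R); apply: separation_le => A mA.
by rewrite mul0e.
Qed.

End separation_bounds.

(** * Product powers of a probability *)

Section product_power_theory.
Context d (T : measurableType d) (R : realType).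
Local Open Scope ereal_scope.
Implicit Types P Q : probability T R.

(** Written with [xsection] so as to be, up to unfolding, the integrand in the
    definition of the product measure. *)
Definition head_section n (A : set (n.+1.-tuple T)) x :=
  xsection (@tuple_cons _ T n @^-1` A) x.

Lemma measurable_preimage_cons n (A : set (n.+1.-tuple T)) : measurable A ->
  measurable (@tuple_cons _ T n @^-1` A).
Proof.
by move=> mA; rewrite -[X in measurable X]setTI; exact: measurable_tuple_cons.
Qed.

Lemma product_powerSE P n (A : set (n.+1.-tuple T)) :
  product_power P n.+1 A =
  \int[P]_x product_power P n (xsection (@tuple_cons _ T n @^-1` A) x).
Proof. by []. Qed.

Lemma measurable_head_section n (A : set (n.+1.-tuple T)) x : measurable A ->
  measurable (head_section A x).
Proof.
by move=> mA; apply: measurable_xsection; exact: measurable_preimage_cons.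
Qed.

Lemma measurable_fun_head_section P n (A : set (n.+1.-tuple T)) :
  measurable A ->
  measurable_fun setT (fun x => product_power P n (head_section A x)).
Proof.
move=> mA.
exact: (measurable_fun_xsection (product_power P n)
  (measurable_preimage_cons mA)).
Qed.

(** Integrate over the first coordinate: both the inner measures and the
    integrating measures are compared up to a factor. *)
Lemma product_power_ge P Q (c : {nonneg R}) n (A : set (n.-tuple T)) :
  (forall B, measurable B -> c%:num%:E * Q B <= P B) -> measurable A ->
  (c%:num ^+ n)%:E * product_power Q n A <= product_power P n A.
Proof.
move=> cQP; elim: n A => [|n IH] A mA; first by rewrite expr0 mul1e.
rewrite !product_powerSE exprS EFinM -muleA -ge0_integralZl//; last first.
  exact: measurable_fun_head_section.
rewrite -ge0_integral_mscale//; last 2 first.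
- by apply: measurable_funeM; exact: measurable_fun_head_section.
- by move=> x _; rewrite mule_ge0// lee_fin exprn_ge0.
apply: (@le_trans _ _ (\int[P]_x ((c%:num ^+ n)%:E *
   product_power Q n (head_section A x)))).
  apply: ge0_le_measure_integral => //.
  - by move=> x; rewrite mule_ge0// lee_fin exprn_ge0.
  - by apply: measurable_funeM; exact: measurable_fun_head_section.
apply: ge0_le_integral => //.
- by move=> x _; rewrite mule_ge0// lee_fin exprn_ge0.
- by apply: measurable_funeM; exact: measurable_fun_head_section.
- exact: measurable_fun_head_section.
- by move=> x _; apply: IH; exact: measurable_head_section.
Qed.

Lemma product_power_dominates P Q n : P `<< Q ->
  product_power P n `<< product_power Q n.
Proof.
move=> /null_content_dominatesP PQ; elim: n => [|n IH] //.
apply/null_content_dominatesP => A mA; rewrite !product_powerSE => QA0.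
have mQ := measurable_fun_head_section Q mA.
have : ae_eq Q setT (fun x => product_power Q n (head_section A x)) (cst 0).
  apply/ae_eq_integral_abs => //.
  by rewrite -[RHS]QA0; apply: eq_integral => x _; rewrite gee0_abs.
move=> [N [mN QN sN]].
have : ae_eq P setT (fun x => product_power P n (head_section A x)) (cst 0).
  exists N; split=> //; first exact: PQ.
  move=> x /= Nx; apply: sN => /= h; apply: Nx => _.
  move/null_content_dominatesP : IH => IH; apply: IH; last exact: h.
  exact: measurable_head_section.
move=> /ae_eq_integral_abs <-//; last exact: measurable_fun_head_section.
by apply: eq_integral => x _; rewrite gee0_abs.
Qed.

Lemma product_power_cube P n (A : set T) : measurable A ->
  product_power P n [set x | forall i, A (tnth x i)] = (fine (P A) ^+ n)%:E.
Proof.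
move=> mA; elim: n => [|n IH].
  by rewrite -[LHS]/(\d_[tuple] _) diracE mem_set ?expr0//; case.
rewrite product_powerSE.
rewrite (eq_integral (fun x => (\1_A x)%:E * (fine (P A) ^+ n)%:E)).
  rewrite ge0_integralZr//.
  - by rewrite integral_indic// setIT exprS EFinM fineK// fin_num_measure.
  - exact/measurable_EFinP/measurable_indic.
  - by rewrite lee_fin exprn_ge0// fine_ge0.
move=> x _; rewrite -IH indicE.
have [/set_mem Ax|] := boolP (x \in A); rewrite ?mul1e ?mul0e.
  congr (product_power P n _); apply/seteqP.
  split=> y; rewrite /xsection /= inE /tuple_cons /=.
    by move=> h i; have := h (lift ord0 i); rewrite tnthS.
  move=> h i; case: (unliftP ord0 i) => [j|] ->; rewrite ?tnthS ?tnth0//.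
rewrite notin_setE => nAx; rewrite -(measure0 (product_power P n)).
congr (product_power P n _).
apply/seteqP; split=> y //; rewrite /xsection /= inE /tuple_cons /= => h.
by apply: nAx; have := h ord0; rewrite tnth0.
Qed.

End product_power_theory.

Arguments head_section {d T n}.

Lemma product_power_distribution d d' (T : measurableType d)
    (T' : measurableType d') (R : realType) (P : probability T R)
    (g : {mfun T >-> T'}) n (A : set (n.-tuple T')) : measurable A ->
  product_power P n ((fun x => [tuple g (tnth x i) | i < n]) @^-1` A) =
  product_power (distribution P g) n A.
Proof.
elim: n A => [|n IH] A mA.
  have e : [tuple g (tnth ([tuple] : 0.-tuple T) i) | i < 0] = [tuple].
    exact: tuple0.
  rewrite -[LHS]/(\d_[tuple] _) -[RHS]/(\d_[tuple] _) !diracE.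
  congr (_%:R%:E); congr nat_of_bool.
  by apply/idP/idP; rewrite !inE /= e.
rewrite !product_powerSE ge0_integral_distribution//; last first.
  exact: measurable_fun_head_section.
apply: eq_integral => x _ /=; rewrite -IH; last exact: measurable_head_section.
congr (product_power P n _); apply/seteqP.
have e (y : n.-tuple T) : [tuple g (tnth [tuple of x :: y] i) | i < n.+1] =
    [tuple of g x :: [tuple g (tnth y i) | i < n]].
  apply: eq_from_tnth => i; rewrite tnth_mktuple.
  by case: (unliftP ord0 i) => [j|] ->; rewrite ?tnthS ?tnth0 ?tnth_mktuple.
by split=> y; rewrite /xsection /tuple_cons /= !inE /= e.
Qed.

(** * Gaussian densities and their cosine integrals *)

Section gaussian_density.
Context {R : realType}.
Implicit Types a m s x y z w : R.

Lemma normal_pdf_expR s : s != 0 -> exists2 p : R, 0 < p &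
  forall m x, normal_pdf m s x = p * expR (- (x - m) ^+ 2 / (2 * s ^+ 2)).
Proof.
move=> s0; exists (normal_peak s); first exact: normal_peak_gt0.
by move=> m x; rewrite normal_pdfE// /normal_fun mulr_natl.
Qed.

(** As [(x - z)^2 >= x^2 / 2 - z^2], small translates of a Gaussian density
    are uniformly dominated by a Gaussian density of twice the variance. This
    is what dominated convergence asks for when differentiating or passing to
    the limit under Gaussian integrals. *)
Lemma normal_pdf_dominated s w : s != 0 -> w != 0 -> w ^+ 2 = 2 * s ^+ 2 ->
  exists K : R, forall z x, `|z| <= 1 ->
    normal_pdf z s x <= K * normal_pdf 0 w x.
Proof.
move=> s0 w0 ws; have [p p0 pE] := normal_pdf_expR s0.
have [q q0 qE] := normal_pdf_expR w0.
exists (p * expR (2 * s ^+ 2)^-1 / q) => z x z1.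
rewrite pE qE mulrA divfK ?gt_eqF// -mulrA ler_pM2l// -expRD ler_expR.
have s2 : 0 < s ^+ 2 by rewrite exprn_even_gt0.
have z2 : z ^+ 2 <= 1 by rewrite -real_normK ?num_real// expr_le1.
rewrite subr0 ws -subr_ge0.
have -> : (2 * s ^+ 2)^-1 + - x ^+ 2 / (2 * (2 * s ^+ 2)) -
    - (x - z) ^+ 2 / (2 * s ^+ 2) =
    (2 * (1 - z ^+ 2) + (x - 2 * z) ^+ 2) / (4 * s ^+ 2).
  by field.
apply: divr_ge0; last by rewrite mulr_ge0// ltW.
by rewrite addr_ge0 ?sqr_ge0// mulr_ge0// subr_ge0.
Qed.

(** Here [|x| <= |s| (1 + u) <= |s| exp u] with [u = x^2 / (4 s^2)], and
    [exp u] costs half of the Gaussian decay. *)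
Lemma normr_normal_pdf_dominated s w : s != 0 -> w != 0 ->
  w ^+ 2 = 2 * s ^+ 2 ->
  exists2 K : R, 0 <= K &
    forall x, `|x| * normal_pdf 0 s x <= K * normal_pdf 0 w x.
Proof.
move=> s0 w0 ws; have [p p0 pE] := normal_pdf_expR s0.
have [q q0 qE] := normal_pdf_expR w0.
exists (`|s| * p / q); first by rewrite divr_ge0 ?mulr_ge0// ltW.
move=> x.
rewrite pE qE mulrA divfK ?gt_eqF// mulrCA [`|s| * p]mulrC -mulrA.
rewrite ler_pM2l//.
have s1 : 0 < `|s| by rewrite normr_gt0.
pose u := x ^+ 2 / (4 * s ^+ 2).
have -> : - (x - 0) ^+ 2 / (2 * s ^+ 2) = - u - u by rewrite /u; field.
have -> : - (x - 0) ^+ 2 / (2 * w ^+ 2) = - u by rewrite ws /u; field.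
rewrite expRD mulrA ler_wpM2r ?expR_ge0// expRN ler_pdivrMr ?expR_gt0//.
apply: (@le_trans _ _ (`|s| * (1 + u))); last first.
  by rewrite ler_wpM2l// expR_ge1Dx.
rewrite -subr_ge0 /u -(real_normK (num_real x)) -(real_normK (num_real s)).
have -> : `|s| * (1 + `|x| ^+ 2 / (4 * `|s| ^+ 2)) - `|x| =
   `|s| * (`|x| / (2 * `|s|) - 1) ^+ 2.
  by field; rewrite gt_eqF.
by rewrite mulr_ge0// sqr_ge0.
Qed.

Lemma exists_sqr_double s : s != 0 ->
  exists2 w, w != 0 & w ^+ 2 = 2 * s ^+ 2.
Proof.
move=> s0; exists (Num.sqrt (2 * s ^+ 2)); last first.
  by rewrite sqr_sqrtr// mulr_ge0// sqr_ge0.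
by rewrite sqrtr_eq0 -ltNge mulr_gt0// exprn_even_gt0.
Qed.

Lemma is_derive_normal_pdf s x : s != 0 ->
  is_derive x 1 (normal_pdf 0 s) (- (x / s ^+ 2) * normal_pdf 0 s x).
Proof.
move=> s0; have [p p0 pE] := normal_pdf_expR s0.
rewrite pE (_ : normal_pdf 0 s =
  fun x => p * expR (- (2 * s ^+ 2)^-1 * x ^+ 2)).
  apply: is_derive_eq.
  rewrite /GRing.scale /= subr0.
  have -> : - x ^+ 2 / (2 * s ^+ 2) = - (2 * s ^+ 2)^-1 * x ^+ 2.
    by rewrite mulNr mulrC mulNr.
  by set e := expR _; field.
apply/funext => y; rewrite pE subr0; congr (_ * expR _).
by rewrite mulNr mulrC mulNr.
Qed.

Local Notation mu := (@lebesgue_measure R).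

Lemma integrable_bounded_normal_pdf m s (f : R -> R) :
  measurable_fun setT f -> (forall x, `|f x| <= 1) ->
  mu.-integrable setT (EFin \o (fun x => f x * normal_pdf m s x)).
Proof.
move=> mf f1; apply: (le_integrable _ _ _ (integrable_normal_pdf m s)) => //.
  apply/measurable_EFinP/measurable_funM => //.
  exact: measurable_normal_pdf.
move=> x _ /=; rewrite lee_fin normrM ler_piMl//.
Qed.

End gaussian_density.

Section gaussian_cosine.
Context {R : realType}.
Variables s b : R.
Hypothesis s0 : s != 0.
Implicit Types a x : R.
Local Notation mu := (@lebesgue_measure R).
Local Notation phi := (normal_pdf 0 s).

Let measurable_cos a : measurable_fun setT (fun x => cos (a * x + b)).
Proof.
apply: (measurableT_comp (continuous_measurable_fun (@continuous_cos R))).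
by apply: measurable_funD => //; exact: measurable_funM.
Qed.

Let measurable_sin a : measurable_fun setT (fun x => sin (a * x + b)).
Proof.
apply: (measurableT_comp (continuous_measurable_fun (@continuous_sin R))).
by apply: measurable_funD => //; exact: measurable_funM.
Qed.

Let f a x := cos (a * x + b) * phi x.
Let df a x := - (x * sin (a * x + b) * phi x).

Let is_derive_f x a : is_derive a 1 (f ^~ x) (df a x).
Proof.
apply: is_derive_eq.
by rewrite /GRing.scale /= /df; ring.
Qed.

Let integrable_f a : mu.-integrable setT (EFin \o f a).
Proof. by apply: integrable_bounded_normal_pdf => // x; exact: cos_max. Qed.

Let df_bound : exists2 G : R -> R, (forall x, 0 <= G x) &
  mu.-integrable setT (EFin \o G) /\ forall a x, `|df a x| <= G x.
Proof.
have [w w0 ws] := exists_sqr_double s0.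
have [K K0 Kle] := normr_normal_pdf_dominated s0 w0 ws.
exists (fun x => K * normal_pdf 0 w x).
  move=> x; apply: le_trans (Kle x).
  by rewrite mulr_ge0// normal_pdf_ge0.
split.
  exact: (@integrableZl _ _ _ mu _ _ K _ (integrable_normal_pdf 0 w)).
move=> a x; apply: le_trans (Kle x).
rewrite /df normrN !normrM [`|phi x|]ger0_norm ?normal_pdf_ge0//.
by rewrite ler_wpM2r ?normal_pdf_ge0// ler_piMr// sin_max.
Qed.

Let integrable_df a : mu.-integrable setT (EFin \o df a).
Proof.
have [G G0 [iG dfG]] := df_bound.
apply: le_integrable iG => //.
  apply/measurable_EFinP; apply: measurableT_comp => //.
  apply: measurable_funM; last exact: measurable_normal_pdf.
  by apply: measurable_funM => //; exact: measurable_sin.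
by move=> x _ /=; rewrite lee_fin (ger0_norm (G0 x)).
Qed.

Let I a := \int[mu]_x f a x.

Let is_derive_I a : is_derive a 1 I (\int[mu]_x df a x).
Proof.
have [G G0 [iG dfG]] := df_bound.
have aI : `]a - 1, a + 1[%classic a.
  by rewrite /= in_itv /= ltrBlDr !ltrDl ltr01.
have dE c x : partial1of2 f c x = df c x.
  by rewrite partial1of2E; apply: derive_val.
apply: DeriveDef.
  apply: (@derivable_under_integral R _ (measurableTypeR R) mu f setT
    measurableT a _ _ aI _ _ G G0 iG) => //.
  by move=> c x _ _; rewrite dE.
rewrite -derive1E (@differentiation_under_integral R _ (measurableTypeR R) mu
  f setT measurableT a _ _ aI _ _ G G0 iG)//.
  by apply: eq_Rintegral => x _; rewrite dE.
by move=> c x _ _; rewrite dE.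
Qed.

Let g a x := a * f a x + s ^- 2 * df a x.

Let F a x := sin (a * x + b) * phi x.

Let is_derive_F a x : is_derive x 1 (F a) (g a x).
Proof.
have ? := is_derive_normal_pdf x s0.
apply: is_derive_eq.
by rewrite /GRing.scale /= /g /f /df; field.
Qed.

Let integrable_g a : mu.-integrable setT (EFin \o g a).
Proof.
rewrite (_ : EFin \o g a =
  (fun x => a%:E * (f a x)%:E + (s ^- 2)%:E * (df a x)%:E)%E); last first.
  by apply/funext => x; rewrite /= /g EFinD !EFinM.
apply: integrableD => //.
  exact: (@integrableZl _ _ _ mu _ measurableT a _ (integrable_f a)).
exact: (@integrableZl _ _ _ mu _ measurableT (s ^- 2) _ (integrable_df a)).
Qed.

Let continuous_g a : continuous (g a).
Proof.
move=> x; apply/differentiable_continuous/derivable1_diffP.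
have ? := is_derive_normal_pdf x s0.
apply: ex_derive.
Qed.

Let integral_itv_g a n :
  (\int[mu]_(x in `[(- n.+1%:R)%R, n.+1%:R%R]) (g a x)%:E =
   (F a n.+1%:R - F a (- n.+1%:R))%:E)%E.
Proof.
have cF x : {for x, continuous (F a)}.
  apply/differentiable_continuous/derivable1_diffP.
  by have ? := is_derive_F a x; apply: ex_derive.
rewrite (continuous_FTC2 (F := F a)).
- by rewrite -EFinB.
- by rewrite gtrN.
- by apply: continuous_subspaceT => x; exact: continuous_g.
- split.
  + by move=> x _; have ? := is_derive_F a x; apply: ex_derive.
  + exact/cvg_at_right_filter/cF.
  + exact/cvg_at_left_filter/cF.
- by move=> x _; rewrite derive1E; have ? := is_derive_F a x; apply: derive_val.
Qed.

Let F_cvg0 a (e : R) : `|e| = 1 -> F a (e * n.+1%:R) @[n --> \oo] --> 0.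
Proof.
move=> e1.
have [w w0 ws] := exists_sqr_double s0.
have [K K0 Kle] := normr_normal_pdf_dominated s0 w0 ws.
have [q q0 qE] := normal_pdf_expR w0.
apply/norm_cvg0P.
apply: (@squeeze_cvgr _ _ _ _ (cst 0) (fun n => (K * q) * n.+1%:R^-1)).
- apply: nearW => n; rewrite normr_ge0 /=.
  rewrite ler_pdivlMr ?ltr0n// /F normrM.
  rewrite [`|phi _|]ger0_norm ?normal_pdf_ge0//.
  apply: (@le_trans _ _ (`|e * n.+1%:R| * phi (e * n.+1%:R))).
    rewrite mulrC normrM e1 mul1r (ger0_norm (ler0n R n.+1)) ler_wpM2l//.
    rewrite ler_piMl ?normal_pdf_ge0//.
    exact: sin_max.
  apply: (le_trans (Kle _)); rewrite qE mulrA ler_piMr//.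
    by rewrite mulr_ge0// ltW.
  rewrite -expR0 ler_expR mulNr oppr_le0 divr_ge0// ?sqr_ge0//.
  by rewrite mulr_ge0// sqr_ge0.
- exact: cvg_cst.
- rewrite -(mulr0 (K * q)); apply: cvgMr; exact: cvg_harmonic.
Qed.

Let integral_g a : \int[mu]_x g a x = 0.
Proof.
pose E n : set R := `[- n.+1%:R, n.+1%:R]%classic.
have mE n : measurable (E n) by exact: measurable_itv.
have mg : measurable_fun setT (EFin \o g a).
  exact: measurable_int (integrable_g a).
have lim_int : (\int[mu]_x ((g a \_ (E n)) x)%R%:E @[n --> \oo] -->
    \int[mu]_x (g a x)%:E)%E.
  apply: (@dominated_cvg _ (measurableTypeR R) R mu setT measurableT
    (fun n x => ((g a \_ (E n)) x)%:E) (EFin \o g a)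
    (fun x => `|(g a x)%:E|%E)) => //.
  - move=> n; apply/measurable_EFinP.
    apply/(measurable_restrictT _ (mE n)).
    by apply: measurable_funTS; exact/measurable_EFinP.
  - move=> x _; apply: cvg_near_cst.
    exists (Num.truncn `|x|) => // n /= xn.
    rewrite patchE mem_set// /E /= in_itv /=.
    rewrite -ler_norml; apply: ltW; apply: lt_le_trans (truncnS_gt _) _.
    by rewrite ler_nat ltnS.
  - exact: integrable_abse (integrable_g a).
  - move=> n x _; rewrite patchE; case: ifP => // _.
    by rewrite -[leLHS]/(`|0%:E|%E) abse0 abse_ge0.
have lim0 : (\int[mu]_x ((g a \_ (E n)) x)%R%:E @[n --> \oo] --> 0)%E.
  rewrite (_ : (fun _ => _) =
    (fun n => (F a n.+1%:R - F a (- n.+1%:R))%:E)); last first.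
    apply/funext => n; rewrite -integral_itv_g [RHS]integral_mkcond.
    by apply: eq_integral => x _; rewrite restrict_EFin.
  apply: cvg_EFin; first exact: nearW.
  rewrite -(subr0 0); apply: cvgB.
    under eq_fun do rewrite -[n in F a n]mul1r.
    by apply: F_cvg0; rewrite normr1.
  by under eq_fun do rewrite -mulN1r; apply: F_cvg0; rewrite normrN1.
rewrite /Rintegral (cvg_unique _ lim_int lim0)//.
Qed.

(** The integral [I a] satisfies [I' a = - s^2 a I a], the equation of
    [exp (- a^2 s^2 / 2)]: differentiating under the integral sign brings down
    a factor [x], and [x phi x = - s^2 phi' x] is integrated by parts, without
    boundary terms. The phase [b] gives the initial value [I 0 = cos b]. *)
Lemma integral_cos_normal_pdf a :
  \int[mu]_x (cos (a * x + b) * normal_pdf 0 s x) =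
  cos b * expR (- (a ^+ 2 * s ^+ 2 / 2)).
Proof.
have I' (c : R) : is_derive c (1 : R) I (- (c * s ^+ 2) * I c).
  apply: (is_derive_eq (is_derive_I c)).
  have : c * I c + s ^- 2 * \int[mu]_x df c x = 0.
    rewrite -(RintegralZl c measurableT (integrable_f c)).
    rewrite -(RintegralZl _ measurableT (integrable_df c)) -RintegralD//.
    + exact: integral_g.
    + exact: (@integrableZl _ _ _ mu _ measurableT c _ (integrable_f c)).
    + exact: (@integrableZl _ _ _ mu _ measurableT _ _ (integrable_df c)).
  move=> /eqP; rewrite addr_eq0 => /eqP e.
  by rewrite mulNr mulrAC e; field.
have J' (c : R) : is_derive c (1 : R)
    (fun c : R => I c * expR (c ^+ 2 * (s ^+ 2 / 2))) 0.
  have ? := I' c; apply: is_derive_eq.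
  rewrite /GRing.scale /=; set e := expR _.
  by field.
have I0 : I 0 = cos b.
  rewrite /I (@eq_Rintegral _ _ _ mu setT
    (fun x => cos b * normal_pdf 0 s x)); last first.
    by move=> x _; rewrite /f mul0r add0r.
  rewrite RintegralZl//; last exact: integrable_normal_pdf.
  by rewrite /Rintegral integral_normal_pdf mulr1.
have := is_derive_0_is_cst a 0 J'.
rewrite expr0n mul0r expR0 mulr1 I0 mulrA => e.
rewrite -/(I a) expRN; apply: (canRL (mulfK _)) => //.
by rewrite gt_eqF// expR_gt0.
Qed.

End gaussian_cosine.

(** * Translations and periodic functions *)

Section lebesgue_translation.
Context {R : realType}.
Local Open Scope ereal_scope.
Implicit Types (a b c : R) (v : R -> \bar R).
Local Notation mu := (@lebesgue_measure R).
Local Notation shift c :=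
  (fun x : measurableTypeR R => (x + c)%R : measurableTypeR R).

Lemma preimage_shift_itv c (i j : bool) a b :
  (shift c) @^-1` [set` Interval (BSide i a) (BSide j b)] =
  [set` Interval (BSide i (a - c)%R) (BSide j (b - c)%R)].
Proof.
apply/seteqP; split=> x; case: i; case: j; rewrite /= !in_itv /=;
  by rewrite !(lerBlDr, ltrBlDr, lerBrDr, ltrBrDr).
Qed.

Lemma lebesgue_measure_shift c (A : set R) : measurable A ->
  pushforward mu (shift c) A = mu A.
Proof.
move=> mA; apply/esym/lebesgue_measure_unique => //=.
  exact: measurable_funD.
move=> ? _ [[a b]] _ <-.
rewrite /pushforward preimage_shift_itv/= !lebesgue_measure_itv/=.
by rewrite !lte_fin ltrD2r -!EFinB opprB addrA subrK.
Qed.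

Lemma ge0_integral_shift c (D : set R) v : measurable D ->
  measurable_fun D v -> {in D, forall x, 0 <= v x} ->
  \int[mu]_(x in D) v x = \int[mu]_(x in (shift c) @^-1` D) v (x + c)%R.
Proof.
move=> mD mv v0.
rewrite -[RHS](@ge0_integral_pushforward _ _ (measurableTypeR R)
  (measurableTypeR R) R (shift c) _ mu D v)//.
  apply: eq_measure_integral; first exact: measurable_funD.
  by move=> mc A mA _; exact/esym/lebesgue_measure_shift.
exact: measurable_funD.
Qed.

End lebesgue_translation.

Section periodic.
Context {R : realType}.
Local Open Scope ereal_scope.
Variable v : R -> \bar R.
Hypotheses (mv : measurable_fun setT v) (v0 : forall x, 0 <= v x).
Hypothesis v_per : forall (m : int) x, v (x + 2 * m%:~R)%R = v x.
Local Notation mu := (@lebesgue_measure R).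

Let shift_period (m : int) (a b : R) :
  \int[mu]_(x in `[(a + 2 * m%:~R)%R, (b + 2 * m%:~R)%R[) v x =
  \int[mu]_(x in `[a, b[) v x.
Proof.
rewrite (ge0_integral_shift (2 * m%:~R))//; last exact: measurable_funTS.
rewrite preimage_shift_itv !addrK.
by apply: eq_integral => x _; exact: v_per.
Qed.

Let split_itv (a b c : R) : (a <= b)%R -> (b <= c)%R ->
  \int[mu]_(x in `[a, c[) v x =
  \int[mu]_(x in `[a, b[) v x + \int[mu]_(x in `[b, c[) v x.
Proof.
move=> ab bc; rewrite -ge0_integral_setU//=; last 2 first.
- exact: measurable_funTS.
- apply/disj_setPS => x [] /=; rewrite !in_itv /= => /andP[_ h] /andP[h' _].
  by rewrite ltNge h' in h.
congr (integral _ _ _); apply/seteqP; split=> x /=; rewrite !in_itv /=.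
  move=> /andP[ax xc]; have [xb|bx] := ltP x b; [left|right].
    by rewrite ax.
  by rewrite xc.
move=> [/andP[h h']|/andP[h h']]; apply/andP; split=> //.
- exact: lt_le_trans bc.
- exact: le_trans h.
Qed.

(** All windows of one period length carry the same integral: cut the window
    at the multiple of the period it contains and move the left part by one
    period. *)
Lemma integral_period (c : R) :
  \int[mu]_(x in `[c, (c + 2)%R[) v x = \int[mu]_(x in `[0%R, 2%R[) v x.
Proof.
pose m := Num.ceil (c / 2); pose p : R := (2 * m%:~R)%R.
have cp : (c <= p)%R.
  by rewrite /p mulrC -ler_pdivrMr// ceil_ge.
have pc : (p <= c + 2)%R.
  have : (m%:~R - 1 < c / 2 :> R)%R.
    by rewrite -[1%R]/(1%:~R) -intrB; exact: ceilB1_lt.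
  by rewrite ltr_pdivlMr// /p; lra.
rewrite (split_itv cp pc) addrC.
have -> : \int[mu]_(x in `[c, p[) v x =
    \int[mu]_(x in `[(c + 2)%R, (p + 2)%R[) v x.
  by rewrite -(shift_period 1 c p) mulr1.
rewrite -split_itv//; last by rewrite lerD2r.
by rewrite -[RHS](shift_period m) add0r addrC.
Qed.

End periodic.

(** * The Fejer kernel *)

Section fejer_kernel.
Context {R : realType}.
Implicit Types (t : R) (m n : nat).

Definition dirichlet m t := 1 + 2 * \sum_(k < m) cos (k.+1%:R * t).

(** The Fejer kernel, up to its normalisation by [n]. *)
Definition fejer n t := \sum_(m < n) dirichlet m t.

Lemma dirichletS m t : dirichlet m.+1 t = dirichlet m t + 2 * cos (m.+1%:R * t).
Proof. by rewrite /dirichlet big_ord_recr /= mulrDr addrA. Qed.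

Lemma fejerS n t : fejer n.+1 t = fejer n t + dirichlet n t.
Proof. by rewrite /fejer big_ord_recr. Qed.

Lemma dirichlet_subr_cos m t :
  dirichlet m t * (1 - cos t) = cos (m%:R * t) - cos (m.+1%:R * t).
Proof.
elim: m => [|m IH].
  by rewrite /dirichlet big_ord0 !mul0r mul1r cos0; ring.
rewrite dirichletS mulrDl IH.
have -> : m.+2%:R * t = m.+1%:R * t + t.
  by rewrite -[m.+2]addn1 natrD mulrDl mul1r.
have -> : m%:R * t = m.+1%:R * t - t.
  by rewrite -[m.+1]addn1 natrD mulrDl mul1r addrK.
by rewrite cosB cosD; ring.
Qed.

(** The factor [1 - cos t] telescopes the sums. This identity yields both the
    positivity of the kernel and its concentration near the multiples of the
    period, where [1 - cos t] vanishes. *)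
Lemma fejer_subr_cos n t : fejer n t * (1 - cos t) = 1 - cos (n%:R * t).
Proof.
elim: n => [|n IH]; first by rewrite /fejer big_ord0 !mul0r cos0 subrr.
by rewrite fejerS mulrDl IH dirichlet_subr_cos; ring.
Qed.

Lemma fejer_mul_subr_cos_le2 n t : fejer n t * (1 - cos t) <= 2.
Proof. by rewrite fejer_subr_cos; have := cos_geN1 (n%:R * t); lra. Qed.

Lemma fejer_ge0 n t : 0 <= fejer n t.
Proof.
have [ct|] := eqVneq (cos t) 1; last first.
  move=> ct; have ct1 : 0 < 1 - cos t by rewrite subr_gt0 lt_neqAle ct cos_le1.
  rewrite -(pmulr_lge0 _ ct1) fejer_subr_cos subr_ge0; exact: cos_le1.
(* the identity is void at a multiple of the period, where all cosines are 1 *)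
have st : sin t = 0 by apply: cos1sin0; rewrite ct normr1.
have ck k : cos (k%:R * t) = 1.
  elim: k => [|k IH]; first by rewrite mul0r cos0.
  by rewrite -[k.+1]addn1 natrD mulrDl mul1r cosD IH ct st mulr0 subr0 mulr1.
rewrite /fejer; apply: sumr_ge0 => m _.
rewrite /dirichlet addr_ge0// mulr_ge0//.
by apply: sumr_ge0 => k _; rewrite ck.
Qed.

Lemma cosD2pi_int t (k : int) : cos (t + 2 * pi * k%:~R) = cos t.
Proof.
have pern (x : R) (j : nat) : cos (x + 2 * pi * j%:R) = cos x.
  have -> : 2 * pi * j%:R = (pi *+ 2) *+ j :> R.
    by rewrite -[RHS]mulr_natr -[pi *+ 2]mulr_natl.
  exact: periodicn (@cosD2pi R) _ _.
case: k => k; first exact: pern.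
by rewrite NegzE mulrNz mulrN -[LHS](pern _ k.+1) subrK.
Qed.

Lemma fejerDpi n t (k : int) :
  fejer n (pi * (t + 2 * k%:~R)) = fejer n (pi * t).
Proof.
rewrite /fejer; apply: eq_bigr => m _; rewrite /dirichlet; congr (1 + 2 * _).
apply: eq_bigr => i _.
rewrite -[RHS](cosD2pi_int _ (i.+1%:Z * k)) intrM; congr cos.
by rewrite -[(i.+1 : int)%:~R]/(i.+1%:R); ring.
Qed.

Lemma continuous_dirichlet m : continuous (dirichlet m).
Proof.
elim: m => [|m IH].
  rewrite (_ : dirichlet 0 = cst 1); first exact: cst_continuous.
  by apply/funext => t; rewrite /dirichlet big_ord0 mulr0 addr0.
rewrite (_ : dirichlet m.+1 = fun t => dirichlet m t + 2 * cos (m.+1%:R * t)).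
  move=> t; apply: cvgD; first exact: IH.
  apply: cvgMr; apply: continuous_comp; last exact: continuous_cos.
  exact: mulrl_continuous.
by apply/funext => t; rewrite dirichletS.
Qed.

Lemma continuous_fejer n : continuous (fejer n).
Proof.
elim: n => [|n IH].
  rewrite (_ : fejer 0 = cst 0); first exact: cst_continuous.
  by apply/funext => t; rewrite /fejer big_ord0.
rewrite (_ : fejer n.+1 = fun t => fejer n t + dirichlet n t).
  by move=> t; apply: cvgD; [exact: IH|exact: continuous_dirichlet].
by apply/funext => t; rewrite fejerS.
Qed.

Lemma measurable_fejer n : measurable_fun [set: R] (fejer n).
Proof. by apply: continuous_measurable_fun; exact: continuous_fejer. Qed.

Local Notation mu := (@lebesgue_measure R).

Let integrable_continuous (f : R -> R) : continuous f ->
  mu.-integrable `[-1, 1]%classic (EFin \o f).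
Proof.
move=> cf; apply: continuous_compact_integrable; first exact: segment_compact.
exact: continuous_subspaceT.
Qed.

Let integral_cos_period k :
  \int[mu]_(z in `[-1, 1]) cos (k.+1%:R * (pi * z)) = 0.
Proof.
have kpi : k.+1%:R * pi != 0 :> R.
  by rewrite mulf_neq0// ?pnatr_eq0// gt_eqF// pi_gt0.
pose F (z : R) : R := sin (k.+1%:R * pi * z) / (k.+1%:R * pi).
have dF (z : R) : is_derive z (1 : R) F (cos (k.+1%:R * (pi * z))).
  apply: is_derive_eq; rewrite /GRing.scale /=.
  by rewrite [in RHS]mulrA !mulr0 add0r mulr1 mulrCA mulVf// mulr1.
have cF x : {for x, continuous F}.
  apply/differentiable_continuous/derivable1_diffP.
  by have ? := dF x; apply: ex_derive.
rewrite /Rintegral (continuous_FTC2 (F := F)).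
- rewrite -EFinB /= /F mulrN1 mulr1 sinN.
  have -> : sin (k.+1%:R * pi) = 0 :> R.
    elim: (k.+1) => [|j IH]; first by rewrite mul0r sin0.
    by rewrite -[j.+1]addn1 natrD mulrDl mul1r sinDpi IH oppr0.
  by rewrite oppr0 mul0r subrr.
- by rewrite gtrN.
- apply: continuous_subspaceT => x.
  apply: continuous_comp; last exact: continuous_cos.
  apply: cvgMr; apply: cvgMr; exact: cvg_id.
- split.
  + by move=> x _; have ? := dF x; apply: ex_derive.
  + exact/cvg_at_right_filter/cF.
  + exact/cvg_at_left_filter/cF.
- by move=> x _; rewrite derive1E; have ? := dF x; apply: derive_val.
Qed.

Let integral_dirichlet m : \int[mu]_(z in `[-1, 1]) dirichlet m (pi * z) = 2.
Proof.
have cpi (f : R -> R) : continuous f -> continuous (fun z => f (pi * z)).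
  move=> cf z; apply: continuous_comp; last exact: cf.
  exact: mulrl_continuous.
elim: m => [|m IH].
  rewrite (@eq_Rintegral _ _ _ mu _ (fun=> 1)); last first.
    by move=> z _; rewrite /dirichlet big_ord0 mulr0 addr0.
  rewrite Rintegral_cst//= lebesgue_measure_itv /= lte_fin gtrN//.
  by rewrite -EFinB /=; lra.
under eq_Rintegral do rewrite dirichletS.
have ccos : continuous (fun z : R => cos (m.+1%:R * (pi * z))).
  apply: (cpi (fun z => cos (m.+1%:R * z))) => z.
  apply: continuous_comp; last exact: continuous_cos.
  exact: mulrl_continuous.
rewrite RintegralD//.
- rewrite IH RintegralZl//; last exact: integrable_continuous.
  by rewrite integral_cos_period mulr0 addr0.
- exact/integrable_continuous/cpi/continuous_dirichlet.
- by apply: integrable_continuous => z; apply: cvgMr; exact: ccos.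
Qed.

Lemma integral_fejer n : \int[mu]_(z in `[-1, 1]) fejer n (pi * z) = 2 * n%:R.
Proof.
have cpi (f : R -> R) : continuous f -> continuous (fun z => f (pi * z)).
  move=> cf z; apply: continuous_comp; last exact: cf.
  exact: mulrl_continuous.
elim: n => [|n IH].
  rewrite (@eq_Rintegral _ _ _ mu _ (fun=> 0)); last first.
    by move=> z _; rewrite /fejer big_ord0.
  by rewrite Rintegral_cst//= mul0r mulr0.
under eq_Rintegral do rewrite fejerS.
rewrite RintegralD//.
- by rewrite IH integral_dirichlet -[n.+1]addn1 natrD mulrDr mulr1.
- exact/integrable_continuous/cpi/continuous_fejer.
- exact/integrable_continuous/cpi/continuous_dirichlet.
Qed.

End fejer_kernel.

(** * Fejer means of the wrapped Gaussian *)

Section fejer_gaussian.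
Context {R : realType}.
Variable s : R.
Hypothesis s0 : s != 0.
Local Notation mu := (@lebesgue_measure R).
Local Notation phi := (normal_pdf 0 s).

(** The first Fourier coefficient of the Gaussian wrapped around the circle of
    length 2; the others are its powers with exponents the squares. *)
Definition wrapped_coef : R := expR (- (pi ^+ 2 * s ^+ 2 / 2)).
Local Notation q := wrapped_coef.

Lemma wrapped_coef_lt1 : q < 1.
Proof.
rewrite /q -[ltRHS]expR0 ltr_expR oppr_lt0 divr_gt0// mulr_gt0//.
  by rewrite exprn_gt0// pi_gt0.
by rewrite exprn_even_gt0.
Qed.

Let measurable_cos_sub k (x : R) :
  measurable_fun setT (fun y : R => cos (k.+1%:R * (pi * (x - y)))).
Proof.
apply: (measurableT_comp (continuous_measurable_fun (@continuous_cos R))).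
apply: measurable_funM => //; apply: measurable_funM => //.
exact: measurable_funB.
Qed.

Let integrable_cos_sub k (x : R) : mu.-integrable setT
  (EFin \o (fun y : R => cos (k.+1%:R * (pi * (x - y))) * phi y)).
Proof.
by apply: integrable_bounded_normal_pdf => // y; exact: cos_max.
Qed.

Let integral_cos_sub_ge k x :
  - q ^+ k.+1 <= \int[mu]_y (cos (k.+1%:R * (pi * (x - y))) * phi y).
Proof.
have -> : \int[mu]_y (cos (k.+1%:R * (pi * (x - y))) * phi y) =
    \int[mu]_y (cos (- (k.+1%:R * pi) * y + k.+1%:R * (pi * x)) * phi y).
  by apply: eq_Rintegral => y _; congr (cos _ * _); ring.
rewrite integral_cos_normal_pdf// /q -expRM_natl.
set c := cos _; set e := expR _; set e' := expR _.
have ee' : e' <= e.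
  rewrite ler_expR mulrN lerN2.
  have -> : (- (k.+1%:R * pi)) ^+ 2 * s ^+ 2 / 2 =
    k.+1%:R ^+ 2 * (pi ^+ 2 * s ^+ 2 / 2) by rewrite sqrrN exprMn !mulrA.
  rewrite ler_wpM2r//; first by rewrite divr_ge0// mulr_ge0 ?sqr_ge0.
  by rewrite expr2 ler_peMr// ler1n.
have e0 : 0 <= e' by exact: expR_ge0.
have : -1 <= c by exact: cos_geN1.
by rewrite -subr_ge0 => c1; nra.
Qed.

Let dirichlet_gaussian m x :
  mu.-integrable setT (EFin \o (fun y => dirichlet m (pi * (x - y)) * phi y)) /\
  1 - 2 * \sum_(k < m) q ^+ k.+1 <=
    \int[mu]_y (dirichlet m (pi * (x - y)) * phi y).
Proof.
elim: m => [|m [IH1 IH2]].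
  have e : (fun y => dirichlet 0 (pi * (x - y)) * phi y) = phi.
    by apply/funext => y; rewrite /dirichlet big_ord0 mulr0 addr0 mul1r.
  rewrite e big_ord0 mulr0 subr0; split; first exact: integrable_normal_pdf.
  by rewrite /Rintegral integral_normal_pdf /= lexx.
have e : (fun y => dirichlet m.+1 (pi * (x - y)) * phi y) =
  (fun y => dirichlet m (pi * (x - y)) * phi y +
     2 * (cos (m.+1%:R * (pi * (x - y))) * phi y)).
  by apply/funext => y; rewrite dirichletS; ring.
have i2 : mu.-integrable setT
    (EFin \o (fun y => 2 * (cos (m.+1%:R * (pi * (x - y))) * phi y))).
  exact: (@integrableZl _ _ _ mu _ measurableT 2 _ (integrable_cos_sub m x)).
rewrite e; split; first exact: (@integrableD _ _ _ mu _ measurableT _ _ IH1 i2).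
rewrite RintegralD// (RintegralZl _ measurableT (integrable_cos_sub m x)).
rewrite big_ord_recr /=.
have := integral_cos_sub_ge m x; move: IH2.
set a := \int[mu]_y _; set b := \int[mu]_y _; set c := \sum_(_ < _) _.
by lra.
Qed.

Let sum_pow_le m : \sum_(k < m) q ^+ k.+1 <= q / (1 - q).
Proof.
have q1 := wrapped_coef_lt1.
have q0 : 0 < q by exact: expR_gt0.
rewrite ler_pdivlMr ?subr_gt0//.
rewrite (_ : (\sum_(k < m) q ^+ k.+1) * (1 - q) = q * (1 - q ^+ m)).
  by apply: ler_piMr; [exact: ltW|rewrite gerBl exprn_ge0// ltW].
elim: m => [|m IH]; first by rewrite big_ord0 expr0 subrr mul0r mulr0.
by rewrite big_ord_recr /= mulrDl IH exprS; ring.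
Qed.

(** Smoothing the Gaussian by the kernel gives a trigonometric polynomial with
    constant term [n], in which the coefficient of [cos (pi k x)] is at most
    [2 n q ^ (k^2) <= 2 n q ^ k]; summing the geometric series bounds what the
    oscillating terms can take off. *)
Lemma fejer_gaussian n x :
  mu.-integrable setT (EFin \o (fun y => fejer n (pi * (x - y)) * phi y)) /\
  n%:R * (1 - 2 * (q / (1 - q))) <=
    \int[mu]_y (fejer n (pi * (x - y)) * phi y).
Proof.
elim: n => [|n [IH1 IH2]].
  have e : (fun y => fejer 0 (pi * (x - y)) * phi y) = cst 0.
    by apply/funext => y; rewrite /fejer big_ord0 mul0r.
  rewrite e mul0r Rintegral_cst// mul0r; split => //.
  by rewrite (_ : EFin \o _ = cst 0%E)//; exact: integrable0.
have [d1 d2] := dirichlet_gaussian n x.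
have e : (fun y => fejer n.+1 (pi * (x - y)) * phi y) =
  (fun y => fejer n (pi * (x - y)) * phi y +
     dirichlet n (pi * (x - y)) * phi y).
  by apply/funext => y; rewrite fejerS mulrDl.
rewrite e; split; first exact: (@integrableD _ _ _ mu _ measurableT _ _ IH1 d1).
rewrite RintegralD//.
rewrite -[n.+1]addn1 natrD [X in X <= _]mulrDl mul1r.
have := sum_pow_le n; move: IH2 d2.
set u := n%:R * _; set v := q / _.
by lra.
Qed.

End fejer_gaussian.

Section gaussian_translates.
Context {R : realType}.
Variable s : R.
Hypothesis s0 : s != 0.
Local Notation mu := (@lebesgue_measure R).
Variable E : set (measurableTypeR R).
Hypothesis mE : measurable E.

Let integrable_E (m w : R) : mu.-integrable E (EFin \o normal_pdf m w).
Proof.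
apply: (integrableS measurableT mE) => //; exact: integrable_normal_pdf.
Qed.

Lemma continuous_normal_prob0 :
  {for 0, continuous (fun z : R => fine (normal_prob z s E))}.
Proof.
have [w w0 ws] := exists_sqr_double s0.
have [K Kle] := normal_pdf_dominated s0 w0 ws.
apply: (@continuity_under_integral R _ (measurableTypeR R) mu
  (fun z x => normal_pdf z s x) E mE (-1) 1 _ _
  (fun x => K * normal_pdf 0 w x)).
- by move=> z _; exact: integrable_E.
- apply: aeW => x _ z _; have [p p0 pE] := normal_pdf_expR s0.
  rewrite (_ : (fun m => normal_pdf m s x) =
    fun m => p * expR (- (x - m) ^+ 2 / (2 * s ^+ 2))); last first.
    by apply/funext => m; rewrite pE.
  apply/differentiable_continuous/derivable1_diffP.
  exact: ex_derive.
- exact: (@integrableZl _ _ _ mu _ mE K _ (integrable_E 0 w)).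
- move=> z; rewrite /= in_itv /= => /andP[z1 z2]; apply: aeW => x _.
  rewrite ger0_norm ?normal_pdf_ge0//; apply: Kle.
  by rewrite ler_norml !ltW.
- by rewrite inE /= in_itv /= ltrN10 ltr01.
Qed.

(** Continuity of translation at the origin, with the modulus written as a
    multiple of [1 - cos (pi z)], against which the Fejer kernel is small. *)
Lemma normal_prob_near0 (e : R) : 0 < e -> exists2 M : R, 0 <= M &
  forall z : R, -1 <= z <= 1 -> fine (normal_prob z s E) <=
    fine (normal_prob 0 s E) + e + M * (1 - cos (pi * z)).
Proof.
move=> e0.
have /cvgrPdist_lt/(_ _ e0)/nbhs_ballP[r /= r0 rE] := continuous_normal_prob0.
pose d := Num.min r 1.
have d0 : 0 < d by rewrite lt_min r0 ltr01.
have d1 : d <= 1 by rewrite ge_min lexx orbT.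
have dpi : pi * d \in `[0, pi].
  by rewrite in_itv /= mulr_ge0 ?pi_ge0 ?(ltW d0)//= ler_piMr// pi_ge0.
have cd : cos (pi * d) < 1.
  rewrite -cos0 ltr_cos//; first by rewrite mulr_gt0// pi_gt0.
  by rewrite in_itv /= lexx pi_ge0.
have c0 z : 0 <= 1 - cos (pi * z) :> R by rewrite subr_ge0 cos_le1.
exists (1 - cos (pi * d))^-1; first by rewrite invr_ge0.
move=> z /andP[zN1 z1].
have M0 : 0 <= (1 - cos (pi * d))^-1 * (1 - cos (pi * z)).
  by rewrite mulr_ge0// invr_ge0.
have [zd|dz] := ltP `|z| d.
  have : `|fine (normal_prob 0 s E) - fine (normal_prob z s E)| < e.
    apply: rE; rewrite /ball /= sub0r normrN.
    by apply: lt_le_trans zd _; rewrite ge_min lexx.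
  by rewrite ltr_norml => /andP[h _]; move: h M0; lra.
apply: (@le_trans _ _ 1).
  rewrite -[leRHS]/(fine 1%:E) fine_le ?fin_num_measure//.
  exact: (probability_le1 (normal_prob z s)).
have : 1 <= (1 - cos (pi * d))^-1 * (1 - cos (pi * z)).
  rewrite mulrC ler_pdivlMr ?subr_gt0// mul1r lerD2l lerN2.
  have -> : cos (pi * z) = cos (pi * `|z|).
    by rewrite -[pi in RHS]ger0_norm ?pi_ge0// -normrM cos_norm.
  have zpi : pi * `|z| \in `[0, pi].
    rewrite in_itv /= mulr_ge0 ?pi_ge0//= ler_piMr ?pi_ge0//.
    by rewrite ler_norml zN1.
  by rewrite leNgt ltr_cos// ltr_pM2l ?pi_gt0// -leNgt.
have : 0 <= fine (normal_prob 0 s E) by exact: fine_ge0.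
by lra.
Qed.

End gaussian_translates.

Section wrapped_gaussian_lower_bound.
Context {R : realType}.
Variable s : R.
Hypothesis s0 : s != 0.
Local Notation mu := (@lebesgue_measure R).
Local Notation phi := (normal_pdf 0 s).
Local Notation q := (wrapped_coef s).
Variable E : set (measurableTypeR R).
Hypothesis mE : measurable E.
Hypothesis E_per : forall (m : int) (x : R), E (x + 2 * m%:~R) <-> E x.
Local Open Scope ereal_scope.
Local Notation D0 := (`[0%R, 2%R[%classic : set (measurableTypeR R)).
Local Notation D1 := (`[(-1)%R, 1%R[%classic : set (measurableTypeR R)).

Let c : R := (1 - 2 * (q / (1 - q)))%R.
Let mD1 : measurable D1. Proof. exact: measurable_itv. Qed.

Let mED0 : measurable (E `&` D0).
Proof. by apply: measurableI => //; exact: measurable_itv. Qed.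

Let measurable_pi_sub : measurable_fun setT
  (fun p : measurableTypeR R * measurableTypeR R => (pi * (p.1 - p.2))%R : R).
Proof. by apply: measurable_funM => //; exact: measurable_funB. Qed.

(** The integral of [kernel] and that of [shifted] are two forms of the mass,
    up to normalisation, that the smoothed and wrapped Gaussian gives to [E]. In the first, the point [x] of [E]
    ranges over one period; in the second it is written [y + z] with the
    displacement [z] in a period centred at the origin. *)
Let kernel n (p : measurableTypeR R * measurableTypeR R) : \bar R :=
  (fejer n (pi * (p.1 - p.2)) * \1_(E `&` D0) p.1 * phi p.2)%:E.

Let measurable_kernel n : measurable_fun setT (kernel n).
Proof.
apply/measurable_EFinP; apply: measurable_funM; last first.
  by apply: measurableT_comp => //; exact: measurable_normal_pdf.
apply: measurable_funM.
  apply: measurableT_comp; last exact: measurable_pi_sub.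
  exact: measurable_fejer.
apply: (measurableT_comp (f := (\1_(E `&` D0) : measurableTypeR R -> R))) => //.
Qed.

Let kernel_ge0 n p : 0 <= kernel n p.
Proof. by rewrite lee_fin !mulr_ge0 ?fejer_ge0 ?normal_pdf_ge0. Qed.

Let shifted n (p : measurableTypeR R * measurableTypeR R) : \bar R :=
  (fejer n (pi * p.1) * \1_D1 p.1)%:E * (\1_E (p.2 + p.1)%R * phi p.2)%:E.

Let measurable_shifted n : measurable_fun setT (shifted n).
Proof.
apply: emeasurable_funM; apply/measurable_EFinP; apply: measurable_funM.
- apply: measurableT_comp; first exact: measurable_fejer.
  by apply: measurable_funM.
- apply: (measurableT_comp (f := (\1_D1 : measurableTypeR R -> R))) => //.
- apply: (measurableT_comp (f := (\1_E : measurableTypeR R -> R))).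
    exact: measurable_indic.
  exact: measurable_funD.
- by apply: measurableT_comp => //; exact: measurable_normal_pdf.
Qed.

Let shifted_ge0 n p : 0 <= shifted n p.
Proof. by rewrite mule_ge0// lee_fin mulr_ge0 ?fejer_ge0 ?normal_pdf_ge0. Qed.

Let integral_kernel_ge n : (0 <= c)%R ->
  (n%:R * c)%:E * mu (E `&` D0) <= \int[mu]_x \int[mu]_y kernel n (x, y).
Proof.
move=> c_ge0.
rewrite -(setIT (E `&` D0)) -integral_indic//.
rewrite -ge0_integralZl//; last 2 first.
- exact/measurable_EFinP/measurable_indic.
- by rewrite lee_fin mulr_ge0.
apply: ge0_le_integral => //.
- by move=> x _; rewrite mule_ge0// lee_fin mulr_ge0.
- by apply: measurable_funeM; exact/measurable_EFinP/measurable_indic.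
- exact: (measurable_fun_fubini_tonelli_F (kernel n) (measurable_kernel n)
    (kernel_ge0 n)).
move=> x _; have [i1 i2] := fejer_gaussian s0 n x.
rewrite (@eq_integral _ (measurableTypeR R) R mu setT
  (fun y => (\1_(E `&` D0) x)%:E *
     (fejer n (pi * ((x : R) - y)) * phi y)%:E)%E); last first.
  by move=> y _; rewrite /kernel /= -EFinM; congr EFin; ring.
rewrite integralZl// muleC lee_wpmul2l ?lee_fin//.
rewrite -(fineK (integrable_fin_num measurableT i1)) lee_fin.
exact: i2.
Qed.

Let integral_kernel_shifted n (y : R) :
  \int[mu]_x kernel n (x, y) = \int[mu]_z shifted n (z, y).
Proof.
pose v (x : R) := (fejer n (pi * (x - y)) * \1_E x)%:E.
have mv : measurable_fun setT v.
  apply/measurable_EFinP; apply: measurable_funM; last exact: measurable_indic.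
  apply: measurableT_comp; first exact: measurable_fejer.
  by apply: measurable_funM => //; exact: measurable_funB.
have v0 x : 0 <= v x by rewrite lee_fin mulr_ge0 ?fejer_ge0.
have v_per (m : int) x : v (x + 2 * m%:~R)%R = v x.
  rewrite /v addrAC fejerDpi; congr (_ * _)%:E; rewrite !indicE; congr (_%:R).
  by congr nat_of_bool; apply/idP/idP; rewrite !inE => /E_per.
have -> : \int[mu]_x kernel n (x, y) = \int[mu]_(x in D0) v x * (phi y)%:E.
  rewrite -ge0_integralZr//; last 2 first.
  - exact: measurable_funTS.
  - by rewrite lee_fin normal_pdf_ge0.
  rewrite [RHS]integral_mkcond; apply: eq_integral => x _.
  rewrite patchE /kernel /v /= indicI -EFinM /=.
  case: ifPn => xD;
    by rewrite [\1_D0 x]indicE ?xD ?(negbTE xD) ?mulr1 ?mulr0 ?mul0r.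
have -> : \int[mu]_(x in D0) v x = \int[mu]_(z in D1) v (z + y)%R.
  rewrite -(integral_period mv v0 v_per (y - 1)).
  rewrite (ge0_integral_shift y)//; last exact: measurable_funTS.
  rewrite preimage_shift_itv.
  have -> : (y - 1 - y = -1)%R by ring.
  by have -> : (y - 1 + 2 - y = 1)%R by ring.
rewrite -ge0_integralZr//; last 2 first.
- apply: measurable_funTS; apply: (measurableT_comp mv).
  exact: measurable_funD.
- by rewrite lee_fin normal_pdf_ge0.
rewrite [LHS]integral_mkcond; apply: eq_integral => z _.
rewrite patchE /shifted /v /= addrK -!EFinM [(y + z)%R]addrC.
case: ifPn => zD; rewrite [\1_D1 z]indicE ?zD ?(negbTE zD).
  by rewrite mulr1 mulrA.
by rewrite mulr0 mul0r.
Qed.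

Let integral_shifted n (z : R) : \int[mu]_y shifted n (z, y) =
  (fejer n (pi * z) * \1_D1 z)%:E * normal_prob z s E.
Proof.
rewrite /shifted /= ge0_integralZl//; last 3 first.
- apply/measurable_EFinP.
  apply: measurable_funM; last exact: measurable_normal_pdf.
  apply: (measurableT_comp (f := (\1_E : measurableTypeR R -> R))) => //.
  exact: measurable_funD.
- by move=> y _; rewrite lee_fin mulr_ge0 ?normal_pdf_ge0.
- by rewrite lee_fin mulr_ge0 ?fejer_ge0.
congr (_ * _); rewrite /normal_prob (ge0_integral_shift z)//; last 2 first.
- apply: measurable_funTS; apply/measurable_EFinP.
  exact: measurable_normal_pdf.
- by move=> x _; rewrite lee_fin normal_pdf_ge0.
rewrite [RHS]integral_mkcond; apply: eq_integral => y _.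
rewrite patchE indicE; have [p _ pE] := normal_pdf_expR s0; case: ifPn => yE.
  have -> : (y + z)%R \in E by move: yE; rewrite !inE.
  by rewrite mul1r !pE addrK subr0.
have -> : ((y + z)%R \in E) = false.
  by apply/negbTE; move: yE; rewrite !notin_setE.
by rewrite mul0r.
Qed.

(** The hypothesis is the continuity estimate of the translates: the kernel has
    mass [2 n] over a period, while its product with [1 - cos] stays below 2. *)
Let integral_shifted_le n (a M : R) : (0 <= a)%R -> (0 <= M)%R ->
  (forall z : R, (-1 <= z <= 1)%R ->
    (fine (normal_prob z s E) <= a + M * (1 - cos (pi * z)))%R) ->
  \int[mu]_z \int[mu]_y shifted n (z, y) <= (a * (2 * n%:R) + 2 * M * 2)%:E.
Proof.
move=> a0 M0 near0.
pose I : set (measurableTypeR R) := `[(-1)%R, 1%R]%classic.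
have mI : measurable I by exact: measurable_itv.
pose h (z : R) := (a * fejer n (pi * z) + 2 * M)%R.
have h0 z : (0 <= h z)%R by rewrite addr_ge0 ?mulr_ge0 ?fejer_ge0.
have mh : measurable_fun setT h.
  apply: measurable_funD => //; apply: measurable_funM => //.
  by apply: measurableT_comp; [exact: measurable_fejer|exact: measurable_funM].
have cfejer :
    {within `[(-1)%R, 1%R], continuous (fun z : R => fejer n (pi * z))}%R.
  apply: continuous_subspaceT => z; apply: continuous_comp.
    exact: mulrl_continuous.
  exact: continuous_fejer.
have ifejer : mu.-integrable I (EFin \o (fun z : R => fejer n (pi * z))).
  by apply: continuous_compact_integrable => //; exact: segment_compact.
have -> : (a * (2 * n%:R) + 2 * M * 2)%:E = \int[mu]_(z in I) (h z)%:E.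
  have ia : mu.-integrable I (EFin \o (fun z : R => a * fejer n (pi * z))%R).
    exact: (@integrableZl _ _ _ mu _ mI a _ ifejer).
  have muI : mu I = 2%:E.
    rewrite /I lebesgue_measure_itv /= lte_fin gtrN// -EFinB; congr EFin; ring.
  have ic : mu.-integrable I (EFin \o cst (2 * M)%R).
    apply: continuous_compact_integrable; first exact: segment_compact.
    by apply: continuous_subspaceT => z; exact: cvg_cst.
  have ih : mu.-integrable I (EFin \o h).
    exact: (@integrableD _ _ _ mu _ mI _ _ ia ic).
  rewrite -[RHS](fineK (integrable_fin_num mI ih)); congr EFin.
  rewrite -[RHS]/(Rintegral mu I h) /h (RintegralD mI ia ic).
  rewrite (RintegralZl _ mI ifejer) integral_fejer Rintegral_cst//.
  by rewrite [X in fine X](_ : _ = 2%:E).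
rewrite [leRHS]integral_mkcond; apply: ge0_le_integral => //.
- by move=> z _; apply: integral_ge0.
- exact: (measurable_fun_fubini_tonelli_F (shifted n) (measurable_shifted n)
    (shifted_ge0 n)).
- apply/(measurable_restrictT _ mI); apply: measurable_funTS.
  exact/measurable_EFinP.
move=> z _; rewrite integral_shifted patchE indicE.
have [zD|zD] := boolP (z \in D1); last first.
  rewrite mulr0 mul0e; case: ifP => _ //.
  by rewrite lee_fin.
have z1 : (-1 <= z <= 1)%R.
  by move: zD; rewrite inE /= in_itv /= => /andP[-> /ltW].
rewrite mem_set /I /= ?in_itv//= mulr1.
have fin : normal_prob z s E \is a fin_num.
  exact: (fin_num_measure (normal_prob z s) E mE).
rewrite -(fineK fin) -EFinM lee_fin /h.
apply: (@le_trans _ _ (fejer n (pi * z) * (a + M * (1 - cos (pi * z))))%R).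
  by rewrite ler_wpM2l ?fejer_ge0 ?near0.
have := fejer_mul_subr_cos_le2 n (pi * z).
set F := fejer _ _; set w := (1 - cos _)%R => Fw.
rewrite mulrDr [(F * a)%R]mulrC lerD2l mulrCA [(2 * M)%R]mulrC.
exact: ler_wpM2l.
Qed.

(** The mass of [E] under the Gaussian smoothed by the normalised kernel is at
    least [c] times its uniform mass, and for [n] large it exceeds the mass
    under the Gaussian itself by as little as desired. *)
Lemma wrapped_gaussian_ge : (0 <= c)%R ->
  (c / 2)%:E * mu (E `&` D0) <= normal_prob 0 s E.
Proof.
move=> c_ge0.
have fin0 : normal_prob 0 s E \is a fin_num.
  exact: (fin_num_measure (normal_prob 0 s) E mE).
have nu0 : (0 <= fine (normal_prob 0 s E))%R by exact: fine_ge0.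
have finl : mu (E `&` D0) \is a fin_num.
  rewrite ge0_fin_numE//; apply: (@le_lt_trans _ _ (mu D0)).
    by rewrite le_measure ?inE//; exact: measurable_itv.
  by rewrite lebesgue_measure_itv /= lte_fin ltr0n -EFinB ltry.
rewrite -(fineK fin0) -(fineK finl) -EFinM lee_fin.
set l := fine (mu _); set nu := fine (normal_prob _ _ _).
apply/ler_addgt0Pr => e e0.
have e20 : (0 < e / 2)%R by rewrite divr_gt0.
have [M M0 near0] := normal_prob_near0 s0 mE e20.
have key n : (n%:R * c * l <= (nu + e / 2) * (2 * n%:R) + 2 * M * 2)%R.
  rewrite -lee_fin EFinM /l (fineK finl).
  apply: (le_trans (integral_kernel_ge n c_ge0)).
  rewrite (fubini_tonelli (kernel n) (measurable_kernel n) (kernel_ge0 n)).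
  under eq_integral do rewrite integral_kernel_shifted.
  rewrite -(fubini_tonelli (shifted n) (measurable_shifted n) (shifted_ge0 n)).
  apply: integral_shifted_le => //.
  by rewrite addr_ge0// ltW.
(* large enough for the error 2 M / n to be at most e / 2 *)
pose n := (Num.truncn (4 * M / e)).+1.
have n0 : (0 < n%:R :> R)%R by rewrite ltr0n.
have nM : (4 * M <= n%:R * e)%R.
  by rewrite -ler_pdivrMr//; apply: ltW; exact: truncnS_gt.
rewrite -(ler_pM2l n0); apply: (@le_trans _ _ ((n%:R * c * l) / 2)%R).
  by rewrite le_eqVlt; apply/orP; left; apply/eqP; ring.
rewrite ler_pdivrMr//; apply: (le_trans (key n)).
by move: nM; set k := n%:R; lra.
Qed.

End wrapped_gaussian_lower_bound.

(** * The Gaussian law wrapped around the circle *)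

Lemma real_in_window {R : realType} (x : R) : exists n : nat,
  n%:R <= x < n%:R + 2 \/ - n%:R <= x < - n%:R + 2.
Proof.
have [x0|x0] := leP 0 x.
  exists (Num.truncn x); left.
  have := truncn_le x; have := truncnS_gt x; rewrite x0 -natr1.
  by move=> h1 h2; apply/andP; split; move: h1 h2; lra.
exists (Num.truncn (- x)).+1; right.
have := truncn_le (- x); have := truncnS_gt (- x).
rewrite oppr_ge0 (ltW x0) -natr1 => h1 h2.
by apply/andP; split; move: h1 h2 x0; lra.
Qed.

Section wrapped_gaussian.
Context {R : realType}.
Variable s : R.
Hypothesis s0 : s != 0.
Local Notation mu := (@lebesgue_measure R).
Local Open Scope ereal_scope.
Local Notation q := (wrapped_coef s).

Definition wrapped_gaussian : probability (circle R) R :=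
  distribution (real_prob (normal_prob 0 s)) (@circle_proj R).

Lemma circle_projD2 (m : int) (x : R) :
  circle_proj (x + 2 * m%:~R) = circle_proj x.
Proof.
apply/eqP; rewrite /circle_proj -Quotient.idealrBE addrC addKr.
by rewrite inE /= mulrAC mulfV// mul1r intr_int.
Qed.

Lemma measurable_circle_preimage (A : set (circle R)) : measurable A ->
  measurable (@circle_proj R @^-1` A : set (measurableTypeR R)).
Proof.
by move=> mA; rewrite -[X in measurable X]setTI; exact: measurable_circle_proj.
Qed.

Let measurable_itvR (i : interval R) :
  measurable ([set` i] : set (measurableTypeR R)).
Proof. exact: measurable_itv. Qed.

Lemma circle_uniformE (A : set (circle R)) : measurable A ->
  circle_uniform R A = 2^-1%:E * mu (@circle_proj R @^-1` A `&` `[0%R, 2%R[).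
Proof.
move=> mA; have mE := measurable_circle_preimage mA.
rewrite -[LHS]/(uniform_prob (@ltr0Sn R 1) (@circle_proj R @^-1` A)).
set E := _ @^-1` A in mE *.
rewrite /uniform_prob integral_uniform_pdf.
rewrite (eq_integral (fun=> 2^-1%:E)); last first.
  by move=> x; rewrite inE /= in_itv /= /uniform_pdf => -[_ ->]; rewrite subr0.
have mI := measurable_itvR.
rewrite integral_cst//; last exact: measurableI.
congr (_ * _).
rewrite -(integral_indic mu (mI _) mE) -(integral_indic mu (mI _) mE).
rewrite integral_itv_bndo_bndc//.
by apply: measurable_funTS; apply/measurable_EFinP; exact: measurable_indic.
Qed.

Lemma wrapped_gaussian_uniform_ge (A : set (circle R)) :
  (0 <= 1 - 2 * (q / (1 - q)))%R -> measurable A ->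
  (1 - 2 * (q / (1 - q)))%:E * circle_uniform R A <= wrapped_gaussian A.
Proof.
move=> c0 mA; rewrite circle_uniformE// muleA -EFinM.
apply: wrapped_gaussian_ge => //; first exact: measurable_circle_preimage.
by move=> m x; rewrite /preimage /= circle_projD2.
Qed.

(** A periodic set that is null over one period is null over each of the
    countably many windows that cover the line. *)
Lemma wrapped_gaussian_dominates : wrapped_gaussian `<< circle_uniform R.
Proof.
apply/null_content_dominatesP => A mA UA0.
have {UA0} : circle_uniform R A = 0 by exact: UA0.
rewrite circle_uniformE//.
have mE := measurable_circle_preimage mA.
rewrite -[wrapped_gaussian A]/(normal_prob 0 s (@circle_proj R @^-1` A)).
set E := _ @^-1` A in mE * => /eqP.
rewrite mule_eq0 eqe invr_eq0 pnatr_eq0 /= => /eqP E0.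
have window (a : R) : mu (E `&` `[a, (a + 2)%R[) = 0.
  have mI := measurable_itvR.
  rewrite -(integral_indic mu (mI _) mE).
  rewrite (integral_period (v := EFin \o \1_E)) ?integral_indic//.
  - by apply/measurable_EFinP; exact: measurable_indic.
  - by move=> x; rewrite lee_fin.
  - move=> m x; rewrite /= !indicE; congr (_%:R%:E); congr nat_of_bool.
    by apply/idP/idP; rewrite !inE /E /= circle_projD2.
have negl (a : R) : mu.-negligible (E `&` `[a, (a + 2)%R[).
  apply/negligibleP; last exact: window.
  by apply: measurableI => //; exact: measurable_itv.
have /null_content_dominatesP := normal_prob_dominates 0 s; apply => //.
apply/negligibleP => //.
pose F n := (E `&` `[n%:R%R, (n%:R + 2)%R[) `|`
  (E `&` `[(- n%:R)%R, (- n%:R + 2)%R[).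
apply: (@negligibleS _ _ _ mu (\bigcup_n F n)); last first.
  apply: negligible_bigcup => n; apply: negligibleU; exact: negl.
move=> x Ex; have [n nx] := real_in_window x; exists n => //.
by case: nx => nx; [left|right]; split=> //=; rewrite in_itv.
Qed.

Lemma integral_normal_prob (f : measurableTypeR R -> R) :
  measurable_fun setT f ->
  (forall x, 0 <= f x <= 2)%R ->
  \int[normal_prob 0 s]_x (f x)%:E = \int[mu]_x (f x * normal_pdf 0 s x)%:E.
Proof.
move=> mf f02.
have dom := normal_prob_dominates 0 s.
have intf : (normal_prob 0 s).-integrable setT (EFin \o f).
  apply: (@le_integrable _ _ _ _ setT measurableT _ (cst 2%:E)) => //.
  - exact/measurable_EFinP.
  - by move=> x _ /=; have /andP[h1 h2] := f02 x; rewrite lee_fin !ger0_norm.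
  - exact: finite_measure_integrable_cst.
rewrite -(Radon_Nikodym_change_of_variables dom measurableT intf).
have mpdf : measurable_fun setT
    (fun x : measurableTypeR R => (normal_pdf 0 s x)%:E).
  by apply/measurable_EFinP; exact: measurable_normal_pdf.
have e : ae_eq mu setT
    (Radon_Nikodym (charge_of_finite_measure (normal_prob 0 s)) mu)
    (fun x => (normal_pdf 0 s x)%:E).
  apply: integral_ae_eq => //; first exact: Radon_Nikodym_integrable.
  by move=> A _ mA; rewrite -Radon_Nikodym_integral.
apply: ae_eq_integral => //.
- apply: emeasurable_funM; first exact/measurable_EFinP.
  by apply: measurable_int; exact: Radon_Nikodym_integrable.
- apply/measurable_EFinP; apply: measurable_funM => //.
  exact: measurable_normal_pdf.
- by apply: filterS e => x /= /[apply] ->; rewrite EFinM.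
Qed.

End wrapped_gaussian.

Section wrapped_gaussian_upper_bound.
Context {R : realType}.
Variable s : R.
Hypothesis s0 : s != 0.
Local Notation mu := (@lebesgue_measure R).
Local Open Scope ereal_scope.
Local Notation q := (wrapped_coef s).

Definition circle_versin (x : circle R) : R := 1 - cos (pi * repr x).

Lemma circle_versin_proj (x : R) :
  circle_versin (circle_proj x) = (1 - cos (pi * x))%R.
Proof.
have : circle_proj (repr (circle_proj x)) = circle_proj x by exact: reprK.
move/eqP; rewrite -Quotient.idealrBE inE /= => /intrP[m em].
rewrite /circle_versin; congr (1 - _)%R.
rewrite -(cosD2pi_int (pi * x) m); congr cos.
have -> : repr (circle_proj x) = (x + 2 * m%:~R)%R.
  by rewrite -em mulrC mulfVK// addrC subrK.
by ring.
Qed.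

Let measurable_versin :
  measurable_fun [set: R] (fun x : R => 1 - cos (pi * x))%R.
Proof.
apply: measurable_funB => //.
apply: (measurableT_comp (continuous_measurable_fun (@continuous_cos R))).
exact: measurable_funM.
Qed.

Lemma measurable_circle_versin : measurable_fun setT circle_versin.
Proof.
move=> _ B mB; rewrite setTI.
rewrite /measurable /= /circle_measurable /image_set_system /= setTI.
rewrite (_ : _ @^-1` _ = (fun x : R => 1 - cos (pi * x))%R @^-1` B); last first.
  by apply/seteqP; split=> x /=; rewrite circle_versin_proj.
rewrite -[X in measurable X]setTI.
exact: measurable_versin.
Qed.

Lemma circle_versin_ge0 x : (0 <= circle_versin x)%R.
Proof. by rewrite subr_ge0 cos_le1. Qed.

Let integral_circle (P : probability (measurableTypeR R) R) :
  \int[distribution (real_prob P) (@circle_proj R)]_x (circle_versin x)%:E =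
  \int[P]_x (1 - cos (pi * x))%:E.
Proof.
have mv : measurable_fun setT (EFin \o circle_versin).
  by apply/measurable_EFinP; exact: measurable_circle_versin.
rewrite ge0_integral_distribution//; last first.
  by move=> x; rewrite lee_fin circle_versin_ge0.
rewrite ge0_integral_distribution//; last 2 first.
- exact: measurableT_comp mv _.
- by move=> x; rewrite lee_fin circle_versin_ge0.
by apply: eq_integral => x _ /=; rewrite circle_versin_proj.
Qed.

Lemma integral_circle_versin_uniform :
  \int[circle_uniform R]_x (circle_versin x)%:E = 1.
Proof.
rewrite integral_circle integral_uniform//; last first.
  by apply/measurable_EFinP; exact: measurable_versin.
rewrite subr0.
pose F (x : R) : R := (x - sin (pi * x) / pi)%R.
have pi0 : pi != 0%R :> R by rewrite gt_eqF// pi_gt0.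
have dF (x : R) : is_derive x (1%R : R) F (1 - cos (pi * x))%R.
  apply: is_derive_eq; rewrite /GRing.scale /=.
  by rewrite !mulr0 add0r mulr1 mulrCA mulVf// mulr1.
have cF x : {for x, continuous F}.
  apply/differentiable_continuous/derivable1_diffP.
  by have ? := dF x; apply: ex_derive.
rewrite (continuous_FTC2 (F := F)).
- rewrite -EFinB -EFinM; congr EFin; rewrite /F.
  have -> : (pi * 2 = pi *+ 2 :> R)%R by rewrite mulr_natr.
  by rewrite sin2pi mulr0 sin0 !mul0r !subr0 mulVf.
- by [].
- apply: continuous_subspaceT => x; apply: cvgB; first exact: cvg_cst.
  apply: continuous_comp; last exact: continuous_cos.
  exact: mulrl_continuous.
- split.
  + by move=> x _; have ? := dF x; apply: ex_derive.
  + exact/cvg_at_right_filter/cF.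
  + exact/cvg_at_left_filter/cF.
- by move=> x _; rewrite derive1E; have ? := dF x; apply: derive_val.
Qed.

Lemma integral_circle_versin_wrapped :
  \int[wrapped_gaussian s]_x (circle_versin x)%:E = (1 - q)%:E.
Proof.
rewrite integral_circle integral_normal_prob//; last first.
  by move=> x; rewrite subr_ge0 cos_le1/=; have := cos_geN1 (pi * x)%R; lra.
(* the phase 0 matches the form of the Gaussian cosine integral *)
have icos : mu.-integrable setT
    (EFin \o (fun x : R => cos (pi * x + 0) * normal_pdf 0 s x)%R).
  apply: integrable_bounded_normal_pdf; last by move=> x; exact: cos_max.
  apply: (measurableT_comp (continuous_measurable_fun (@continuous_cos R))).
  by apply: measurable_funD => //; exact: measurable_funM.
have ipdf := integrable_normal_pdf 0 s.
pose h (x : R) : R :=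
  (normal_pdf 0 s x - cos (pi * x + 0) * normal_pdf 0 s x)%R.
have -> : (fun x : measurableTypeR R =>
    ((1 - cos (pi * x)) * normal_pdf 0 s x)%:E) = (EFin \o h).
  by apply/funext => x /=; rewrite /h addr0 mulrBl mul1r.
have intB : mu.-integrable setT (EFin \o h).
  exact: (@integrableB _ _ _ mu _ measurableT _ _ ipdf icos).
rewrite -(fineK (integrable_fin_num measurableT intB)); congr EFin.
rewrite -[LHS]/(Rintegral mu setT h) /h RintegralB// integral_cos_normal_pdf//.
by rewrite /Rintegral integral_normal_pdf cos0 mul1r.
Qed.

(** Otherwise the wrapped Gaussian is [1 - t] times the uniform law plus a
    positive measure of mass [t]. The uniform law does not see [cos (pi x)], so
    the integral [q] of this function would come from the second part and be at
    most [t]. The function [1 - cos (pi x)] is used to stay nonnegative. *)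
Lemma wrapped_gaussian_uniform_lt (t : R) : (t < q)%R ->
  exists2 A, measurable A &
    wrapped_gaussian s A < (1 - t)%:E * circle_uniform R A.
Proof.
move=> tq; apply: contrapT => H.
have t1 : (0 <= 1 - t)%R.
  by rewrite subr_ge0 ltW// (lt_trans tq)// wrapped_coef_lt1.
have ge (A : set (circle R)) : measurable A ->
    (1 - t)%:E * circle_uniform R A <= wrapped_gaussian s A.
  by move=> mA; rewrite leNgt; apply/negP => lt; apply: H; exists A.
have mv : measurable_fun setT (EFin \o circle_versin).
  by apply/measurable_EFinP; exact: measurable_circle_versin.
have v0 x : 0 <= (circle_versin x)%:E by rewrite lee_fin circle_versin_ge0.
pose k := NngNum t1.
have : \int[mscale k (circle_uniform R)]_x (circle_versin x)%:E <=
    \int[wrapped_gaussian s]_x (circle_versin x)%:E.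
  exact: ge0_le_measure_integral.
rewrite ge0_integral_mscale// integral_circle_versin_uniform.
rewrite integral_circle_versin_wrapped mule1 lee_fin /=.
by move: tq; lra.
Qed.

End wrapped_gaussian_upper_bound.

(** * Brownian motion on the torus *)

Section bounds_on_the_torus.
Context d (Omega : measurableType d) (R : realType) (P : probability Omega R).
Variables (n : nat) (B : R -> {mfun Omega >-> n.-tuple R}).
Hypothesis brownianB : brownian_motion P B.
Local Open Scope ereal_scope.

Let measurable_increment (s t : R) : measurable_fun setT (increment B s t).
Proof.
apply/measurable_fun_tnthP => i.
rewrite (_ : _ \o _ = (fun w => tnth (B t w) i - tnth (B s w) i)%R); last first.
  by apply/funext => w; rewrite /= tnth_mktuple.
by apply: measurable_funB; apply: (measurableT_comp (measurable_tnth i)).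
Qed.

(** Almost surely the position at time [t] is the increment from time 0, whose
    coordinates are independent centred Gaussians of variance [t]. *)
Lemma torus_brownian_law_product (t : R) (A : set (torus R n)) :
  (0 < t)%R -> measurable A -> torus_brownian_law P B t A =
  product_power (wrapped_gaussian (Num.sqrt t)) n A.
Proof.
move=> t0 mA; have [B0 _ gaussB _] := brownianB.
have mA' : measurable (@torus_proj R n @^-1` A).
  by rewrite -[X in measurable X]setTI; exact: measurable_torus_proj.
set A' := _ @^-1` A in mA'.
have mpre (f : Omega -> n.-tuple R) :
    measurable_fun setT f -> measurable (f @^-1` A').
  by move=> mf; rewrite -[X in measurable X]setTI; exact: mf.
rewrite /wrapped_gaussian -product_power_distribution//.
rewrite -[X in _ = product_power _ _ X]/A'.
have := gaussB 0%R t A' (lexx _) t0 mA'; rewrite subr0 => <-.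
rewrite -[LHS]/(P (B t @^-1` A')).
have PE (X : set Omega) : measurable X -> P X = \int[P]_w (\1_X w)%:E.
  by move=> mX; rewrite integral_indic// setIT.
have mB : measurable (B t @^-1` A') by exact: mpre.
have mI : measurable (increment B 0 t @^-1` A') by exact: mpre.
rewrite (PE _ mB) (PE _ mI); apply: ge0_ae_eq_integral => //.
- exact/measurable_EFinP/measurable_indic.
- exact/measurable_EFinP/measurable_indic.
apply: filterS B0 => w Bw0 _; rewrite !indicE.
have e : increment B 0 t w = B t w.
  by apply: eq_from_tnth => i; rewrite tnth_mktuple Bw0 tnth_mktuple subr0.
congr (_%:R%:E); congr nat_of_bool.
by apply/idP/idP; rewrite !inE /preimage /= e.
Qed.

Variable t : R.
Hypothesis t0 : (0 < t)%R.
Let s : R := Num.sqrt t.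
Let s0 : s != 0%R. Proof. by rewrite sqrtr_eq0 -ltNge. Qed.
Local Notation q := (wrapped_coef s).

Lemma torus_brownian_law_dominates :
  torus_brownian_law P B t `<< torus_uniform R n.
Proof.
apply/null_content_dominatesP => A mA UA0.
have := product_power_dominates (n := n) (wrapped_gaussian_dominates s).
move/null_content_dominatesP => /(_ A mA UA0) WA0.
rewrite -[LHS]/(torus_brownian_law P B t A) torus_brownian_law_product//.
Qed.

Lemma separation_torus_le : (0 <= 1 - 2 * (q / (1 - q)))%R ->
  separation (torus_brownian_law P B t) (torus_uniform R n) <=
  (1 - (1 - 2 * (q / (1 - q))) ^+ n)%:E.
Proof.
move=> c0; apply: separation_le => [|A mA].
  exact: torus_brownian_law_dominates.
rewrite torus_brownian_law_product//.
apply: (@product_power_ge _ _ _ _ _ (NngNum c0)) => // X mX.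
exact: wrapped_gaussian_uniform_ge.
Qed.

(** The set on which one coordinate is too sparse gives, to the power [n], a
    cube on which the density of the product is on average below
    [(1 - u) ^ n]. *)
Lemma separation_torus_ge (u : R) : (u < q)%R ->
  (1 - (1 - u) ^+ n)%:E <=
  separation (torus_brownian_law P B t) (torus_uniform R n).
Proof.
move=> uq; have [A mA WA] := wrapped_gaussian_uniform_lt s0 uq.
have u1 : (0 <= 1 - u)%R.
  by rewrite subr_ge0 ltW// (lt_trans uq)// wrapped_coef_lt1.
have mcube : measurable [set x : torus R n | forall i, A (tnth x i)].
  rewrite (_ : [set _ | _] =
    \bigcap_(i in [set: 'I_n]) ((@tnth n _ ^~ i) @^-1` A)); last first.
    by apply/seteqP; split=> x /= h i; [move=> _; exact: h|exact: (h i)].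
  apply: fin_bigcap_measurable => // i _.
  by rewrite -[X in measurable X]setTI; exact: measurable_tnth.
have Ufin : circle_uniform R A \is a fin_num by exact: fin_num_measure.
have Wfin : wrapped_gaussian s A \is a fin_num by exact: fin_num_measure.
have U0 : (0 < fine (circle_uniform R A))%R.
  rewrite lt_neqAle fine_ge0// andbT eq_sym; apply/eqP => UA0.
  move: WA; rewrite -(fineK Ufin) UA0 mule0.
  by rewrite ltNge measure_ge0.
apply: (separation_ge torus_brownian_law_dominates
  (A := [set x | forall i, A (tnth x i)])) => //.
- by rewrite exprn_ge0.
- by rewrite product_power_cube// lte_fin exprn_gt0.
rewrite torus_brownian_law_product// !product_power_cube// -EFinM lee_fin.
rewrite -exprMn.
rewrite lerXn2r ?nnegrE ?mulr_ge0 ?fine_ge0//.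
by rewrite -lee_fin EFinM !fineK// ltW.
Qed.

End bounds_on_the_torus.

(** * Cutoff *)

Section cutoff.
Context {R : realType}.

Lemma cvg_expRN_ln (k : R) : 0 < k ->
  expR (- (k * ln n%:R)) @[n --> \oo] --> 0.
Proof.
move=> k0; apply/cvgrPdist_lt => e e0; near=> n.
rewrite sub0r normrN ger0_norm ?expR_ge0//.
have en : expR (- ln e / k) < n%:R by near: n; exact: nbhs_infty_gtr.
have n0 : 0 < n%:R :> R by apply: lt_trans en; exact: expR_gt0.
rewrite -[ltRHS]lnK ?posrE// ltr_expR ltrNl mulrC -ltr_pdivrMr//.
by rewrite -[ltLHS]expRK ltr_ln ?posrE// expR_gt0.
Unshelve. all: by end_near. Qed.

(** Bernoulli's inequality. *)
Lemma one_sub_expr_ge (y : R) n : 0 <= y <= 1 -> 1 - n%:R * y <= (1 - y) ^+ n.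
Proof.
move=> /andP[y0 y1]; elim: n => [|n IH]; first by rewrite mul0r subr0 expr0.
rewrite exprS; apply: (@le_trans _ _ ((1 - y) * (1 - n%:R * y))); last first.
  by rewrite ler_wpM2l// subr_ge0.
rewrite -natr1 -subr_ge0.
rewrite (_ : _ - _ = n%:R * (y * y)); last by ring.
by rewrite !mulr_ge0.
Qed.

Lemma cutoff_time_gt0 n : (2 <= n)%N -> 0 < cutoff_time R n.
Proof.
by move=> n2; rewrite divr_gt0 ?exprn_gt0 ?pi_gt0// mulr_gt0// ln_gt0// ltr1n.
Qed.

(** The coefficient is [n ^ (- a)] at [a] times the cutoff time. *)
Lemma wrapped_coef_cutoff (a : R) n : (2 <= n)%N -> 0 < a ->
  wrapped_coef (Num.sqrt (a * cutoff_time R n)) = expR (- (a * ln n%:R)).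
Proof.
move=> n2 a0; rewrite /wrapped_coef sqr_sqrtr; last first.
  by rewrite mulr_ge0// ltW// cutoff_time_gt0.
have pi0 : pi != 0 :> R by rewrite gt_eqF// pi_gt0.
rewrite /cutoff_time; congr (expR (- _)).
by move: (pi : R) pi0 => p p0; field.
Qed.

End cutoff.

Theorem theorem9 (R : realType) (d : nat -> measure_display)
    (Omega : forall n : nat, measurableType (d n))
    (P : forall n : nat, probability (Omega n) R)
    (B : forall n : nat, R -> {mfun Omega n >-> n.-tuple R})
    (brownianB : forall n : nat, (2 <= n)%N -> brownian_motion (P n) (B n)) :
  (forall r : R, 0 < r ->
    separation (torus_brownian_law (P n) (B n) ((1 + r) * cutoff_time R n))
               (torus_uniform R n) @[n --> \oo] --> 0%:E) /\
  (forall r : R, 0 < r < 1 ->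
    separation (torus_brownian_law (P n) (B n) ((1 - r) * cutoff_time R n))
               (torus_uniform R n) @[n --> \oo] --> 1%:E).
Proof.
split=> r.
- move=> r0.
  have r1 : 0 < 1 + r by rewrite addr_gt0.
  (* the separation is at most 1 - (1 - 4 q)^n <= 4 n q with n q = n^(-r) *)
  apply: (@squeeze_cvge _ _ _ _ (cst 0%:E)
    _ (fun n => (4 * expR (- (r * ln n%:R)))%:E)); last 2 first.
  + exact: cvg_cst.
  + apply: cvg_EFin; first exact: nearW.
    by rewrite -(mulr0 4); apply: cvgMr; exact: cvg_expRN_ln.
  near=> n.
  (* from n = 4 on, 4 q <= 4 / n <= 1 *)
  have n4 : (4 <= n)%N by near: n; exact: nbhs_infty_ge.
  have n2 : (2 <= n)%N by apply: leq_trans n4.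
  have n0 : 0 < n%:R :> R by rewrite ltr0n (leq_trans _ n2).
  have t0 : 0 < (1 + r) * cutoff_time R n by rewrite mulr_gt0// cutoff_time_gt0.
  have bm := brownianB n n2.
  rewrite separation_ge0/=; last exact: torus_brownian_law_dominates.
  set q := wrapped_coef (Num.sqrt ((1 + r) * cutoff_time R n)).
  have qE : q = n%:R^-1 * expR (- (r * ln n%:R)).
    rewrite /q wrapped_coef_cutoff// mulrDl mul1r opprD expRD.
    by congr (_ * _); rewrite expRN lnK ?posrE.
  have e1 : expR (- (r * ln n%:R)) <= 1 :> R.
    rewrite -[leRHS]expR0 ler_expR oppr_le0 mulr_ge0 ?(ltW r0)// ln_ge0//.
    by rewrite ler1n (leq_trans _ n2).
  have q0 : 0 < q by exact: expR_gt0.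
  have q4 : 4 * q <= 1.
    rewrite qE mulrA.
    apply: mulr_ile1 => //; rewrite ?expR_ge0 ?mulr_ge0 ?invr_ge0//.
    by rewrite ler_pdivrMr// mul1r ler_nat.
  have frac : q / (1 - q) <= 2 * q.
    rewrite ler_pdivrMr; last by move: q4; lra.
    by rewrite mulrAC ler_peMl ?(ltW q0)//; move: q4; lra.
  have c0 : 0 <= 1 - 2 * (q / (1 - q)) by move: frac q4; lra.
  apply: (le_trans (separation_torus_le bm t0 c0)).
  rewrite -/q lee_fin lerBlDr -lerBlDl.
  apply: (@le_trans _ _ ((1 - 4 * q) ^+ n)); last first.
    by rewrite lerXn2r ?nnegrE//; move: frac q4; lra.
  apply: le_trans (one_sub_expr_ge n _); last first.
    by apply/andP; split; move: q0 q4; lra.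
  by rewrite qE mulrCA mulVKf ?gt_eqF// mulrCA.
- move=> /andP[r0 r1].
  have r1' : 0 < 1 - r by rewrite subr_gt0.
  have r2 : 0 < r / 2 by rewrite divr_gt0.
  (* the separation is at least 1 - (1 - q / 2)^n >= 1 - exp (- n q / 2), and
     n q = n^r exceeds r log n *)
  apply: (@squeeze_cvge _ _ _ _ (fun n => (1 - expR (- (r / 2 * ln n%:R)))%:E)
    _ (cst 1%:E)); last 2 first.
  + apply: cvg_EFin; first exact: nearW.
    rewrite -[X in _ --> X]subr0; apply: cvgB; first exact: cvg_cst.
    exact: cvg_expRN_ln.
  + exact: cvg_cst.
  near=> n.
  have n2 : (2 <= n)%N by near: n; exact: nbhs_infty_ge.
  have n0 : 0 < n%:R :> R by rewrite ltr0n (leq_trans _ n2).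
  have t0 : 0 < (1 - r) * cutoff_time R n by rewrite mulr_gt0// cutoff_time_gt0.
  have bm := brownianB n n2.
  rewrite separation_le1 ?andbT; last exact: torus_brownian_law_dominates.
  set q := wrapped_coef (Num.sqrt ((1 - r) * cutoff_time R n)).
  have q0 : 0 < q by exact: expR_gt0.
  have q21 : q / 2 < q by move: q0; lra.
  have q1 : q < 1.
    by apply: wrapped_coef_lt1; rewrite sqrtr_eq0 -ltNge.
  apply: le_trans (separation_torus_ge bm t0 q21).
  rewrite lee_fin lerD2l lerN2.
  have nq : n%:R * q = expR (r * ln n%:R).
    rewrite /q wrapped_coef_cutoff// mulrBl mul1r opprB expRD expRN.
    rewrite lnK ?posrE//.
    by rewrite mulrCA mulfV ?gt_eqF// mulr1.
  apply: (@le_trans _ _ (expR (- (q / 2)) ^+ n)).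
    rewrite lerXn2r ?nnegrE ?expR_ge0//; first by move: q1; lra.
    exact: expR_ge1Dx.
  rewrite -expRM_natl ler_expR mulrN lerN2 mulrA nq mulrAC ler_pM2r//.
  by apply: le_trans (expR_ge1Dx _); rewrite lerDr.
Unshelve. all: by end_near. Qed.
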